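(* There are universal constants $c,C>0$ with the following property. Let $\mu\in\mathbb R^m$ be unknown. Suppose that a sampler returns independent draws from a law $\widehat Q$ on $\mathbb R^m$ satisfying $\mathsf{TV}(\widehat Q,\mathcal N(\mu,I_m))\le\varepsilon$, and that an independent sampler returns (independent copies of) a random vector $\Delta\in\mathbb R^m$. Fix $0<\delta\le1/2$, put $p=\lceil C\log(2/\delta)\rceil$, and assume $\|\Delta\|_{L^p}:=(\mathbb E\|\Delta\|^p)^{1/p}\le b$. If $\mathtt B\in(0,1]$ satisfies $$\sqrt p\,b+b^2\le c\,\mathtt B,$$ then the hidden mean correction algorithm (described in the context) with clipping level $\mathtt B$ returns a draw with law $\widehat P$ satisfying $$\mathsf{TV}\bigl(\widehat P,\ \mathcal N(\mu+\mathbb E\Delta,\,I_m)\bigr)\le\delta+C\varepsilon,$$ and uses in expectation at most $1+C\mathtt B$ calls to the sampler of $\widehat Q$ and at most $C\mathtt B$ calls to the sampler of $\Delta$. (Neither $\mu$ nor $\mathbb E\Delta$ is supplied to the algorithm.)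
   Context: FORS (first-order rejection sampling) with bound $\mathtt B$: given a sampler for a proposal law $Q$ and, for each proposal $\omega$, a sampler for a random estimator $W_\omega\in[-\mathtt B,\mathtt B]$, repeat until acceptance: draw $\omega\sim Q$ and independently $M\sim\mathsf{Poisson}(2\mathtt B)$; conditionally on $\omega$ draw independent copies $W^{(1)}_\omega,\dots,W^{(M)}_\omega$ of $W_\omega$; accept and return $\omega$ with probability $\prod_{k=1}^M\frac{\mathtt B+W_\omega^{(k)}}{2\mathtt B}$. $\operatorname{clip}_{\mathtt B}(u)=\max(-\mathtt B,\min(u,\mathtt B))$. Hidden mean correction algorithm: run FORS with bound $\mathtt B$ where the proposal is $Y\sim\widehat Q$, and the tilt estimator draws independent $Y'\sim\widehat Q$ and a copy of $\Delta$ and returns $\operatorname{clip}_{\mathtt B}\langle\Delta,Y-Y'\rangle$. Return the accepted $Y$. *)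

(* Defs.v *)
(* R^m is represented by [m.-tuple R] with its product sigma-algebra. *)
From HB Require Import structures.
From mathcomp Require Import all_boot all_order all_algebra.
From mathcomp Require Import all_classical all_reals all_analysis.

Set Implicit Arguments.
Unset Strict Implicit.
Unset Printing Implicit Defensive.

Import Order.TTheory GRing.Theory Num.Theory.
Import numFieldNormedType.Exports.

Local Open Scope classical_set_scope.
Local Open Scope ring_scope.

Section Vectors.
Context {R : realType} {m : nat}.
Implicit Types u v : m.-tuple R.

Definition vadd u v : m.-tuple R := [tuple tnth u i + tnth v i | i < m].
Definition vsub u v : m.-tuple R := [tuple tnth u i - tnth v i | i < m].
Definition dotp u v : R := \sum_(i < m) tnth u i * tnth v i.
Definition enorm u : R := Num.sqrt (dotp u u).

Definition mean (D : probability (m.-tuple R) R) : m.-tuple R :=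
  [tuple fine 'E_D[fun x => tnth x i] | i < m].

End Vectors.

Definition clip {R : realType} (B u : R) : R := Num.max (- B) (Num.min u B).

Definition TV d (T : measurableType d) (R : realType)
    (P Q : set T -> \bar R) : \bar R :=
  ereal_sup [set `|P A - Q A|%E | A in measurable].

Section ProductProbability.
Context d1 d2 (T1 : measurableType d1) (T2 : measurableType d2) {R : realType}.
Variables (P1 : probability T1 R) (P2 : probability T2 R).

Definition prod_prob : set (T1 * T2) -> \bar R := (P1 \x P2)%E.

HB.instance Definition _ := Measure.on prod_prob.

Let prod_prob_setT : prod_prob setT = 1%E.
Proof.
have -> : prod_prob setT = (P1 setT * P2 setT)%E.
  by rewrite /prod_prob -setXTT product_measure1E.
by rewrite !probability_setT mule1.
Qed.

HB.instance Definition _ :=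
  @Measure_isProbability.Build _ _ R prod_prob prod_prob_setT.

End ProductProbability.

Section Gaussian.
Context {R : realType}.

(* [normal_prob] is carried by [measurableTypeR R]; this is N(a, 1) on [R]
   itself, whose measurable sets are definitionally the same. *)
Definition normal1 (a : R) : set R -> \bar R := normal_prob a 1.

Let normal1_0 a : normal1 a set0 = 0%E.
Proof. exact: (@measure0 _ _ _ (normal_prob a 1)). Qed.

Let normal1_ge0 a A : (0 <= normal1 a A)%E.
Proof. exact: (@measure_ge0 _ _ _ (normal_prob a 1)). Qed.

Let normal1_sigma_additive a : semi_sigma_additive (normal1 a).
Proof. exact: (@measure_semi_sigma_additive _ _ _ (normal_prob a 1)). Qed.

HB.instance Definition _ a := isMeasure.Build _ _ _ (normal1 a)
  (normal1_0 a) (@normal1_ge0 a) (@normal1_sigma_additive a).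

Let normal1_setT a : normal1 a setT = 1%E.
Proof. exact: (@probability_setT _ _ _ (normal_prob a 1)). Qed.

HB.instance Definition _ a :=
  @Measure_isProbability.Build _ _ R (normal1 a) (normal1_setT a).

Definition tuple_cons m (x : R * m.-tuple R) : m.+1.-tuple R :=
  [tuple of x.1 :: x.2].

Let measurable_tuple_cons m : measurable_fun setT (@tuple_cons m).
Proof. exact: measurable_cons. Qed.

HB.instance Definition _ m :=
  isMeasurableFun.Build _ _ _ _ (@tuple_cons m) (@measurable_tuple_cons m).

(* N(mu, I_m) as the product of the one-dimensional laws N(mu_i, 1). *)
Fixpoint gaussian m : m.-tuple R -> probability (m.-tuple R) R :=
  match m with
  | 0 => fun mu => \d_mu
  | m'.+1 => fun mu =>
      distribution (prod_prob (normal1 (thead mu))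
                              (gaussian [tuple of behead mu]))
                   (@tuple_cons m')
  end.

Lemma gaussian_box m (mu : m.-tuple R) (A : 'I_m -> set R) :
  (forall i, measurable (A i)) ->
  gaussian mu [set x | forall i, A i (tnth x i)] =
  (\prod_(i < m) normal_prob (tnth mu i) 1 (A i))%E.
Proof.
elim: m mu A => [|m IH] mu A mA.
  rewrite big_ord0 /= diracE mem_set//; by case.
rewrite big_ord_recl.
transitivity (prod_prob (normal1 (thead mu)) (gaussian [tuple of behead mu])
    (A ord0 `*` [set x | forall i, A (lift ord0 i) (tnth x i)])).
  rewrite /= /distribution /pushforward; congr (prod_prob _ _ _).
  apply/seteqP; split => [[x y] /= H|[x y] /= [Hx Hy] i].
    split; first by have := H ord0.
    by move=> i; have := H (lift ord0 i); rewrite tnthS.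
  by have [j ->|->] := unliftP ord0 i; rewrite ?tnthS.
rewrite /prod_prob product_measure1E//; last first.
  rewrite (_ : [set x | _] = \bigcap_(i in [set: 'I_m])
     ((fun x : m.-tuple R => tnth x i) @^-1` A (lift ord0 i))); last first.
    by apply/seteqP; split => [x H i _|x H i]; apply: H.
  apply: fin_bigcap_measurable => // i _.
  by rewrite -[X in measurable X]setTI; apply: measurable_tnth.
congr (_ * _)%E; transitivity (\prod_(i < m) normal_prob (tnth [tuple of behead mu] i) 1
  (A (lift ord0 i)))%E; first exact: (IH _ (fun i => A (lift ord0 i))).
apply: eq_bigr => i _; congr (normal_prob _ _ _).
by rewrite [in RHS](tuple_eta mu) tnthS.
Qed.

End Gaussian.

(* Mutual independence of a family of random elements, [G i] being the class of
   events determined by the i-th of them. *)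
Definition mutually_independent d (W : measurableType d) (R : realType)
    (P : probability W R) (I : eqType) (G : I -> set (set W)) : Prop :=
  forall (s : seq I) (A : I -> set W), uniq s ->
    (forall i, i \in s -> G i (A i)) ->
    P (\bigcap_(i in [set` s]) A i) = (\prod_(i <- s) P (A i))%E.

(* The draws made by FORS: in round n, the proposal, the Poisson number of
   estimator calls, the internal randomness of the k-th estimator call, and the
   uniform variable deciding acceptance. *)
Inductive fors_draw : Type :=
| Proposal of nat | Count of nat | Seed of nat & nat | Coin of nat.

HB.instance Definition _ := gen_eqMixin fors_draw.

Section FORS.
Context {R : realType} d (W : measurableType d) (P : probability W R)
  dT (T : measurableType dT) (Q : probability T R)
  dS (S : measurableType dS) (K : probability S R) (B : R).

(* An infinite supply of the draws of every potential round; a run only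
   consumes those of the rounds it reaches. [poisson_prob] ignores its second
   argument. *)
Record fors_source : Type := ForsSource {
  proposal : nat -> {mfun W >-> T};
  count : nat -> {mfun W >-> nat};
  seed : nat -> nat -> {mfun W >-> S};
  coin : nat -> {mfun W >-> R};
  proposal_law n A : measurable A -> distribution P (proposal n) A = Q A;
  count_law n A : distribution P (count n) A = poisson_prob (2 * B) 0 A;
  seed_law n k A : measurable A -> distribution P (seed n k) A = K A;
  coin_law n A : measurable A ->
    distribution P (coin n) A = uniform_prob (@ltr01 R) A;
  draws_independent : mutually_independent P (fun i : fors_draw =>
    match i with
    | Proposal n => g_sigma_algebra_preimage (proposal n)
    | Count n => g_sigma_algebra_preimage (count n)
    | Seed n k => g_sigma_algebra_preimage (seed n k)
    | Coin n => g_sigma_algebra_preimage (coin n)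
    end) }.

(* [est y z] is the value of the estimator W_y on internal randomness z. *)
Variables (src : fors_source) (est : T -> S -> R).

Definition fors_accept_prob (n : nat) (w : W) : R :=
  \prod_(k < count src n w)
    ((B + est (proposal src n w) (seed src n k w)) / (2 * B)).

Definition fors_accept (w : W) : pred nat :=
  fun n => coin src n w <= fors_accept_prob n w.

Definition fors_reached (n : nat) (w : W) : bool :=
  [forall j : 'I_n, ~~ fors_accept w j].

(* The proposal of the first accepting round; an arbitrary value if FORS does
   not terminate. *)
Definition fors_output (w : W) : T :=
  match pselect (exists n, fors_accept w n) with
  | left ex => proposal src (ex_minn ex) w
  | right _ => point
  end.

Definition fors_proposal_calls (w : W) : \bar R :=
  (\sum_(n <oo) (if fors_reached n w then 1 else 0))%E.

Definition fors_estimator_calls (w : W) : \bar R :=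
  (\sum_(n <oo) (if fors_reached n w then (count src n w)%:R%:E else 0))%E.

End FORS.

Section HiddenMeanCorrection.
Context {R : realType} d (W : measurableType d) (P : probability W R) (m : nat)
  (Q D : probability (m.-tuple R) R) (B : R).

(* One estimator call draws the pair (Y', Delta). *)
Definition hmc_source := fors_source P Q (prod_prob Q D) B.

Definition hmc_est (y : m.-tuple R) (z : m.-tuple R * m.-tuple R) : R :=
  clip B (dotp z.2 (vsub y z.1)).

Variable src : hmc_source.

Definition hmc_output : W -> m.-tuple R := fors_output src hmc_est.

Definition hmc_Q_calls (w : W) : \bar R :=
  (fors_proposal_calls src hmc_est w + fors_estimator_calls src hmc_est w)%E.

Definition hmc_Delta_calls : W -> \bar R := fors_estimator_calls src hmc_est.

End HiddenMeanCorrection.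

(* Main.v *)
Require Import Defs.
From HB Require Import structures.
From mathcomp Require Import all_boot all_order all_algebra.
From mathcomp Require Import all_classical all_reals all_analysis.
From mathcomp Require Import measurable_realfun.
From mathcomp Require Import ring lra.

Set Implicit Arguments.
Unset Strict Implicit.
Unset Printing Implicit Defensive.

Import Order.TTheory GRing.Theory Num.Theory.
Import numFieldNormedType.Exports.

Local Open Scope classical_set_scope.
Local Open Scope ring_scope.

(* Given y, FORS accepts with probability E q(y)^N = exp (2 B (q(y) - 1)), where
   N is Poisson(2 B) and q(y) is the mean of (B + W_y) / (2 B). The output thus
   has density proportional to exp (E W_y) with respect to the proposal law. For
   the proposal N(mu, I) and the unclipped estimator, E W_y = <E Delta, y - mu>,
   and tilting N(mu, I) by this exponent shifts its mean to mu + E Delta.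
   Replacing Q by N(mu, I), both as proposal and inside the estimator, costs
   O(eps) in total variation. Clipping changes the exponent by at most
   B^(1 - p) E |<Delta, y - Y'>|^p, whose tilted Gaussian integral is controlled
   by moment generating functions at scale sqrt p / |Delta|. *)

(** * Integrating out one of several independent draws *)

(** Independence is given only for events of single draws. It is upgraded to a Fubini rule by
    tracking, for each draw j, measurability with respect to all draws but j. Laws are compared
    before normalisation. The rate equals exp (E W_y - B), and the matching target measure has
    density exp (<E Delta, y - mu> - B) with respect to N(mu, I), of total mass exp (|E Delta|^2 / 2
    - B) >= exp (- 1) >= 1/4. A uniform error e over events, the whole space included, therefore
    costs at most 8 e after normalisation. The exponent <E Delta, y - mu> is unbounded above, so the
    clipping error has to be integrated against the weight 1 + exp <E Delta, y - mu>; this is why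
    the moments are tilted. With p of order log (2 / delta), the factor (sqrt p b / B)^p <= exp (- 4
    p) absorbs the growth exp (3 p / 2) of the generating functions and leaves less than delta. *)

Section Independence.
Context d (W : measurableType d) (R : realType) (P : probability W R)
  (I : eqType) (G : I -> set_system W).
Hypothesis mG : forall i A, G i A -> measurable A.
Hypothesis GT : forall i, G i setT.
Hypothesis GI : forall i A B, G i A -> G i B -> G i (A `&` B).
Hypothesis indep : mutually_independent P G.

Definition other_events (j : I) : set_system W :=
  \bigcup_(i in [set i | i != j]) G i.

(** A pi-system containing [other_events j], to which mutual independence applies literally;
    [other_events j] itself need not be stable under intersection. *)
Let cylinders (j : I) : set_system W :=
  [set A | exists (s : seq I) (F : I -> set W),
    [/\ uniq s, j \notin s, forall i, i \in s -> G i (F i)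
      & A = \bigcap_(i in [set` s]) F i]].

Let measurable_cylinder j A : cylinders j A -> measurable A.
Proof.
move=> [s [F [us js FG ->]]].
by apply: fin_bigcap_measurable => //= i ist; exact: mG (FG _ ist).
Qed.

Let cylinders_setI j : setI_closed (cylinders j).
Proof.
move=> A B [s [F [us js FG ->]]] [t [H [ut jt HG ->]]].
exists (undup (s ++ t)), (fun i => (if i \in s then F i else setT) `&`
  (if i \in t then H i else setT)); split.
- exact: undup_uniq.
- by rewrite mem_undup mem_cat negb_or js.
- move=> i _; apply: GI; case: ifPn => // ?; [exact: FG|exact: HG].
- apply/seteqP; split => [w [Fw Hw] i _|w FHw].
    by split; case: ifPn => // ?; [exact: Fw|exact: Hw].
  split => i ist; have : [set` undup (s ++ t)] i
    by rewrite /= mem_undup mem_cat; apply/orP; by [left|right].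
  + by move/FHw => []; rewrite (_ : (i \in s) = true).
  + by move/FHw => []; rewrite (_ : (i \in t) = true).
Qed.

(** Pi-lambda argument with [B] fixed: both sides are finite measures in [A] that agree on
    [cylinders j], hence on the sigma-algebra it generates. *)
Lemma independent_of_others j A B :
  <<s other_events j >> A -> G j B -> (P (A `&` B) = P A * P B)%E.
Proof.
move=> sA GB; have mB := mG GB.
have PBE : P B = (fine (P B))%:E by rewrite fineK// fin_num_measure.
have PB0 : 0 <= fine (P B) by exact: fine_ge0.
have sub : <<s other_events j >> `<=` <<s cylinders j >>.
  apply: smallest_sub; first exact: smallest_sigma_algebra.
  move=> C [i /= ij GC]; apply: sub_sigma_algebra.
  exists [:: i], (fun=> C); split => //=.
  - by rewrite inE eq_sym.
  - by move=> k; rewrite inE => /eqP ->.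
  - by apply/seteqP; split => [w Cw k _ //|w /(_ i)]; apply; rewrite /= inE.
pose H := [set X | cylinders j X /\ X `<=` setT].
have HE : H = cylinders j by apply/seteqP; split => [X []|X ?].
have := @g_sigma_algebra_measure_unique_trace _ R W (cylinders j) setT measurableT.
rewrite -/H HE => /(_ (@measurable_cylinder j) (@cylinders_setI j)).
move=> /(_ (mrestr P mB) (mscale (NngNum PB0) P)) uniq_trace.
suff : mrestr P mB A = mscale (NngNum PB0) P A.
  by rewrite /= /mrestr /mscale/= -PBE muleC.
apply: uniq_trace => //.
- by rewrite /= /mrestr /mscale/= setTI probability_setT mule1.
- move=> C [s [F [us js FG ->]]].
  rewrite /= /mrestr /mscale/= -PBE.
  have Bnj i : i \in s -> i != j by move=> ?; apply: contraNneq js => <-.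
  (* [B] becomes the coordinate [j] of a longer cylinder, so that independence applies to
     [j :: s]. *)
  have -> : \bigcap_(i in [set` s]) F i `&` B =
      \bigcap_(i in [set` j :: s]) (if i == j then B else F i).
    apply/seteqP; split => [w [Fw Bw] i|w Fw].
      by case: eqP => // /eqP /negbTE ij /=; rewrite inE ij => /Fw.
    split; last by have := Fw j; rewrite /= inE !eqxx; exact.
    by move=> i ist; have := Fw i; rewrite /= inE (negbTE (Bnj _ ist)) ist; exact.
  rewrite indep/=; last 2 first.
  + by rewrite js.
  + move=> i; rewrite inE; case: eqP => [-> //|_ /= ist]; exact: FG.
  rewrite big_cons eqxx indep//; congr (_ * _)%E.
  by apply: eq_big_seq => i /Bnj/negbTE ->.
- rewrite /= /mrestr setTI.
  by rewrite (le_lt_trans (probability_le1 P mB))// ltry.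
- exact: sub.
Qed.

Section Integration.
Context dS (S : measurableType dS) (K : probability S R) (j : I).
Variable Z : {mfun W >-> S}.
Hypothesis ZG : forall B, measurable B -> G j (Z @^-1` B).
Hypothesis ZK : forall B, measurable B -> distribution P Z B = K B.

Local Notation Wj := (g_sigma_algebraType (other_events j)).

Let measurable_Wj (A : set Wj) : measurable A -> measurable (A : set W).
Proof.
move=> mA; apply: (@smallest_sub _ (sigma_algebra setT) (other_events j)) mA.
  exact: sigma_algebra_measurable.
by move=> B [i _]; exact: mG.
Qed.

(** The identity onto the same space with the coarser sigma-algebra; its law is the law of all draws
    but [j]. *)
Let forget : W -> Wj := idfun.

Let measurable_forget : measurable_fun setT forget.
Proof. by move=> _ A mA; rewrite setTI; exact: measurable_Wj. Qed.

HB.instance Definition _ := isMeasurableFun.Build _ _ _ _ _ measurable_forget.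

Let joint (w : W) : Wj * S := (forget w, Z w).

Let measurable_joint : measurable_fun setT joint.
Proof. exact: measurable_fun_pair. Qed.

HB.instance Definition _ := isMeasurableFun.Build _ _ _ _ _ measurable_joint.

Lemma measurable_fun_others d' (V : measurableType d') (f : Wj -> V) :
  measurable_fun setT f -> measurable_fun setT (f : W -> V).
Proof. by move=> mf; exact: measurableT_comp mf measurable_forget. Qed.

(** Measurability of [f] on [Wj * S] says that it sees the draw [j] only through its second
    argument. By independence the law of [joint] is the product of the marginals, and Tonelli
    integrates [Z] first. *)
Lemma integrate_out (f : Wj * S -> \bar R) : measurable_fun setT f ->
  (forall x, 0 <= f x)%E ->
  (\int[P]_w f (w, Z w) = \int[P]_w \int[K]_z f (w, z))%E.
Proof.
move=> mf f0.
transitivity (\int[pushforward P joint]_x f x)%E.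
  by rewrite ge0_integral_pushforward.
transitivity (\int[(distribution P forget \x K)%E]_x f x)%E.
  apply: eq_measure_integral => A mA _.
  apply/esym; apply: (@product_measure_unique _ _ _ _ _ (distribution P forget) K
    (distribution P joint)) => // B C mB mC.
  transitivity (P B * distribution P Z C)%E; last by rewrite ZK.
  exact: (@independent_of_others j B (Z @^-1` C) mB (ZG mC)).
rewrite fubini_tonelli1// ge0_integral_pushforward//.
- exact: measurable_fun_fubini_tonelli_F.
- by move=> w _; apply: integral_ge0.
Qed.

End Integration.
End Independence.

(** * Poisson, uniform and density integrals *)

Section DiscreteIntegral.
Context {R : realType}.
Local Open Scope ereal_scope.

Lemma ge0_integral_nat (mu : {measure set nat -> \bar R}) (f : nat -> \bar R) :
  (forall k, 0 <= f k) ->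
  \int[mu]_k f k = \sum_(k <oo) (f k * mu [set k]).
Proof.
move=> f0.
have <- : \bigcup_k [set k] = [set: nat].
  by apply/seteqP; split => // k _; exists k.
rewrite ge0_integral_bigcup//; last first.
  by move=> i j _ _ [x [/= <- <-]].
apply: eq_eseriesr => k _.
rewrite (eq_integral (cst (f k))); last by move=> x; rewrite inE/= => ->.
by rewrite integral_cst//.
Qed.

Lemma expR_nneseries (x : R) : (0 <= x)%R ->
  \sum_(k <oo) (x ^+ k / k`!%:R)%:E = (expR x)%:E.
Proof.
move=> x0; rewrite expRE -EFin_lim; last first.
  rewrite /pseries/=; under eq_fun do rewrite mulrC.
  exact: is_cvg_series_exp_coeff.
apply/congr_lim/funext => n/=; rewrite /pseries/= /series/= -sumEFin//.
by under eq_bigr do rewrite mulrC.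
Qed.

Lemma poisson_prob_set1 (r : R) k : (0 < r)%R ->
  poisson_prob r 0 [set k] = (r ^+ k / k`!%:R * expR (- r))%:E.
Proof.
by move=> r0; rewrite /poisson_prob r0 esum_set1 /poisson_pmf ?r0//
  lee_fin !mulr_ge0// ?exprn_ge0 ?expR_ge0// ltW.
Qed.

Lemma poisson_pgf (r q : R) : (0 < r)%R -> (0 <= q)%R ->
  \int[poisson_prob r 0]_k (q ^+ k)%:E = (expR (r * (q - 1)))%:E.
Proof.
move=> r0 q0; rewrite ge0_integral_nat; last first.
  by move=> k; rewrite lee_fin exprn_ge0.
transitivity (\sum_(k <oo)
    ((expR (- r))%:E * ((r * q) ^+ k / k`!%:R)%:E)).
  apply: eq_eseriesr => k _; rewrite /= (poisson_prob_set1 k r0) -!EFinM; congr EFin.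
  by rewrite exprMn_comm; [ring|exact: mulrC].
rewrite nneseriesZl; last first.
  by move=> k _; rewrite lee_fin divr_ge0// exprn_ge0// mulr_ge0// ltW.
rewrite expR_nneseries ?mulr_ge0 ?(ltW r0)// -EFinM -expRD; congr (expR _)%:E.
by ring.
Qed.

Lemma poisson_mean (r : R) : (0 < r)%R ->
  \int[poisson_prob r 0]_k (k%:R)%:E = r%:E.
Proof.
move=> r0; rewrite ge0_integral_nat//.
have t0 k : 0 <= ((k%:R : R)%:E) * poisson_prob r 0 [set k].
  by rewrite mule_ge0.
rewrite (nneseries_split 0%N 1%N)// add0n big_nat1 mul0e add0e.
rewrite -(@nneseries_addn _ _ 1%N)//.
transitivity (\sum_(k <oo)
    ((r * expR (- r))%:E * (r ^+ k / k`!%:R)%:E)).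
  apply: eq_eseriesr => k _; rewrite addn1.  rewrite /= (poisson_prob_set1 k.+1 r0) -!EFinM.
  congr EFin; rewrite factS natrM exprS.
  have k1 : k.+1%:R != 0%R :> R by rewrite pnatr_eq0.
  have kf : k`!%:R != 0%R :> R by rewrite pnatr_eq0 -lt0n fact_gt0.
  by move: k1 kf; move: (k.+1%:R) (k`!%:R) => a b a0 b0; field; rewrite a0 b0.
rewrite nneseriesZl; last first.
  by move=> k _; rewrite lee_fin divr_ge0// exprn_ge0// ltW.
rewrite expR_nneseries ?(ltW r0)// -EFinM; congr EFin.
by rewrite -mulrA -expRD addNr expR0 mulr1.
Qed.

End DiscreteIntegral.

Section Uniform01.
Context {R : realType}.
Local Open Scope ereal_scope.

(* The uniform law on [0, 1], carried by [R] itself rather than by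
   [measurableTypeR R]. *)
Definition uniform01 : set R -> \bar R := uniform_prob (@ltr01 R).

Let uniform01_0 : uniform01 set0 = 0.
Proof. exact: (@measure0 _ _ _ (uniform_prob (@ltr01 R))). Qed.

Let uniform01_ge0 A : 0 <= uniform01 A.
Proof. exact: (@measure_ge0 _ _ _ (uniform_prob (@ltr01 R))). Qed.

Let uniform01_sigma_additive : semi_sigma_additive uniform01.
Proof. exact: (@measure_semi_sigma_additive _ _ _ (uniform_prob (@ltr01 R))). Qed.

HB.instance Definition _ := isMeasure.Build _ _ _ uniform01
  uniform01_0 uniform01_ge0 uniform01_sigma_additive.

Let uniform01_setT : uniform01 setT = 1.
Proof. exact: (@probability_setT _ _ _ (uniform_prob (@ltr01 R))). Qed.

HB.instance Definition _ :=
  @Measure_isProbability.Build _ _ R uniform01 uniform01_setT.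

Lemma uniform01_le (t : R) : (0 <= t <= 1)%R ->
  uniform01 [set u | (u <= t)%R] = t%:E.
Proof.
move=> /andP[t0 t1].
rewrite /uniform01 /uniform_prob integral_uniform_pdf.
have -> : [set u | (u <= t)%R] `&` `[0%R, 1%R]%classic = `[0%R, t]%classic.
  apply/seteqP; split => x; rewrite /= !in_itv/=.
    by move=> [-> /andP[->]].
  by move=> /andP[-> xt]; rewrite xt (le_trans xt).
rewrite (eq_integral (cst 1)); last first.
  move=> x; rewrite inE/= in_itv/= => /andP[x0 xt].
  by rewrite /uniform_pdf x0 (le_trans xt t1)/= subr0 invr1.
rewrite integral_cst//= mul1e lebesgue_measure_itv/= lte_fin.
by case: ltgtP t0 => // [_|<-]; rewrite ?sube0// oppr0 adde0.
Qed.

Lemma integral_uniform01_le (t : R) : (0 <= t <= 1)%R ->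
  \int[uniform01]_u ((u <= t)%R%:R : R)%:E = t%:E.
Proof.
move=> t01; transitivity (uniform01 [set u | (u <= t)%R]); last exact: uniform01_le.
rewrite -[X in _ = uniform01 X]setIT -integral_indic//; last first.
  rewrite (_ : [set u | (u <= t)%R] = `]-oo, t]%classic); last first.
    by apply/seteqP; split => u; rewrite /= in_itv.
  exact: measurable_itv.
by apply: eq_integral => u _; rewrite indicE mem_setE.
Qed.

End Uniform01.

Section Density.
Context d (T : measurableType d) (R : realType).
Local Open Scope ereal_scope.

Context (mu nu : {measure set T -> \bar R}) (g : T -> R).
Hypothesis mg : measurable_fun setT g.
Hypothesis g0 : forall x, (0 <= g x)%R.
Hypothesis nuE : forall A, measurable A -> nu A = \int[mu]_(x in A) (g x)%:E.

Import HBNNSimple.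

Let integral_density_indic E : measurable E ->
  \int[nu]_x (\1_E x)%:E = \int[mu]_x ((\1_E x)%:E * (g x)%:E).
Proof.
move=> mE; rewrite integral_indic// setIT nuE//.
rewrite integral_mkcond; apply: eq_integral => x _.
by rewrite patchE indicE; case: ifPn => _; rewrite ?mul1e ?mul0e.
Qed.

Let mgE : measurable_fun setT (EFin \o g).
Proof. exact/measurable_EFinP. Qed.

Let integral_density_nnsfun (f : {nnsfun T >-> R}) :
  \int[nu]_x (f x)%:E = \int[mu]_x ((f x)%:E * (g x)%:E).
Proof.
under [LHS]eq_integral do rewrite fimfunE -fsumEFin//.
rewrite [LHS]ge0_integral_fsum//; last 2 first.
  - by move=> r; exact/measurable_EFinP/measurableT_comp.
  - by move=> n x _; rewrite EFinM nnfun_muleindic_ge0.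
under [RHS]eq_integral.
  move=> x xD; rewrite fimfunE -fsumEFin// muleC ge0_mule_fsumr; last first.
    by move=> r; rewrite EFinM nnfun_muleindic_ge0.
  over.
rewrite [RHS]ge0_integral_fsum//; last 2 first.
  - move=> r; apply: emeasurable_funM => //.
    by apply/measurable_EFinP; do 2 apply/measurableT_comp => //.
  - move=> n x _; rewrite EFinM mule_ge0//; last by rewrite nnfun_muleindic_ge0.
    by rewrite lee_fin.
apply: eq_fsbigr => r _.
(* The sum runs over all reals; a negative value is not attained, and any other can be pulled out of
   a nonnegative integral. *)
have [r0|r0] := leP 0%R r; last first.
  have e0 : f @^-1` [set r] = set0.
    by apply/seteqP; split => x //= fx; have : (0 <= f x)%R by []; rewrite fx leNgt r0.
  rewrite e0; under eq_integral do rewrite indic0 mulr0.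
  under [RHS]eq_integral do rewrite indic0 mulr0 mule0.
  by rewrite !integral0.
under eq_integral do rewrite EFinM.
rewrite ge0_integralZl//; last first.
  exact/measurable_EFinP/measurable_indic.
rewrite integral_density_indic// -ge0_integralZl//.
- by apply: eq_integral => x _; rewrite -!EFinM; congr EFin; ring.
- apply: emeasurable_funM => //.
  exact/measurable_EFinP/measurable_indic.
- by move=> x _; rewrite mule_ge0 ?lee_fin.
Qed.

Lemma ge0_integral_density (f : T -> \bar R) : measurable_fun setT f ->
  (forall x, 0 <= f x) ->
  \int[nu]_x f x = \int[mu]_x (f x * (g x)%:E).
Proof.
move=> mf f0; pose f_ := nnsfun_approx measurableT mf.
transitivity (limn (fun n => \int[nu]_x (f_ n x)%:E)).
  rewrite -monotone_convergence//=.
  - by apply: eq_integral => x _; apply/esym/cvg_lim => //; exact: cvg_nnsfun_approx.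
  - by move=> n; exact/measurable_EFinP.
  - by move=> n x _; rewrite lee_fin.
  - by move=> x _ a b ab; rewrite lee_fin; exact/lefP/nd_nnsfun_approx.
rewrite [X in limn X](_ : _ = (fun n => \int[mu]_x ((f_ n x)%:E * (g x)%:E))).
  rewrite -monotone_convergence//=.
  - apply: eq_integral => x _; apply/cvg_lim => //.
    by apply: cvgeZr => //; exact: cvg_nnsfun_approx.
  - by move=> n; apply: emeasurable_funM => //; exact/measurable_EFinP.
  - by move=> n x _; rewrite mule_ge0 ?lee_fin.
  - move=> x _ a b ab; rewrite lee_wpmul2r ?lee_fin//.
    by exact/lefP/nd_nnsfun_approx.
by apply/funext => n; exact: integral_density_nnsfun.
Qed.

End Density.

(** * The law and the cost of FORS *)

(** The preimage is a countable union over the value of the index. This handles products whose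
    number of factors is the random Poisson count. *)
Lemma measurable_fun_nat_index d1 d2 (X : measurableType d1) (Y : measurableType d2)
    (N : X -> nat) (g : nat -> X -> Y) :
  measurable_fun setT N -> (forall k, measurable_fun setT (g k)) ->
  measurable_fun setT (fun x => g (N x) x).
Proof.
move=> mN mg _ A mA; rewrite setTI.
have -> : (fun x => g (N x) x) @^-1` A =
    \bigcup_k (N @^-1` [set k] `&` g k @^-1` A).
  apply/seteqP; split => [x Ax|x [k _ [/= <-]]//].
  by exists (N x).
apply: bigcup_measurable => k _; apply: measurableI.
- by rewrite -[X in measurable X]setTI; exact: mN.
- by rewrite -[X in measurable X]setTI; exact: mg.
Qed.

(** * Measurability with respect to all draws but one *)

Section DrawEvents.
Context {R : realType} d (W : measurableType d) (P : probability W R)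
  dT (T : measurableType dT) (Q : probability T R)
  dS (S : measurableType dS) (K : probability S R) (B : R).
Variable src : fors_source P Q K B.

Definition draw_events (i : fors_draw) : set_system W :=
  match i with
  | Proposal n => g_sigma_algebra_preimage (proposal src n)
  | Count n => g_sigma_algebra_preimage (Defs.count src n)
  | Seed n k => g_sigma_algebra_preimage (seed src n k)
  | Coin n => g_sigma_algebra_preimage (coin src n)
  end.

Definition draw_round (i : fors_draw) : nat :=
  match i with
  | Proposal n => n | Count n => n | Seed n _ => n | Coin n => n
  end.

Let preimage_measurable dV (V : measurableType dV) (f : {mfun W >-> V}) A :
  g_sigma_algebra_preimage f A -> measurable A.
Proof. by move=> [C mC <-]; exact: measurable_funP. Qed.

Let preimageT dV (V : measurableType dV) (f : W -> V) :
  g_sigma_algebra_preimage f setT.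
Proof. by exists setT => //; rewrite setTI preimage_setT. Qed.

Let preimageI dV (V : measurableType dV) (f : W -> V) A C :
  g_sigma_algebra_preimage f A -> g_sigma_algebra_preimage f C ->
  g_sigma_algebra_preimage f (A `&` C).
Proof.
move=> [A' mA <-] [C' mC <-]; exists (A' `&` C'); first exact: measurableI.
by rewrite !setTI preimage_setI.
Qed.

Lemma draw_events_measurable i A : draw_events i A -> measurable A.
Proof. by case: i => [n|n|n k|n]; exact: preimage_measurable. Qed.

Lemma draw_eventsT i : draw_events i setT.
Proof. by case: i => [n|n|n k|n]; exact: preimageT. Qed.

Lemma draw_eventsI i A C :
  draw_events i A -> draw_events i C -> draw_events i (A `&` C).
Proof. by case: i => [n|n|n k|n]; exact: preimageI. Qed.

(* The probability space equipped with the events determined by all draws but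
   [j]; measurability on it expresses that a quantity does not involve [j]. *)
Definition without (j : fors_draw) : measurableType _ :=
  g_sigma_algebraType (other_events draw_events j).

Let measurable_without dV (V : measurableType dV) (f : W -> V) i j :
  (forall A, measurable A -> draw_events i (f @^-1` A)) -> i != j ->
  measurable_fun setT (f : without j -> V).
Proof.
move=> fG ij _ A mA; rewrite setTI; apply: sub_sigma_algebra.
by exists i => //; exact: fG.
Qed.

Lemma measurable_proposal n j : Proposal n <> j ->
  measurable_fun setT (proposal src n : without j -> T).
Proof.
by move=> /eqP; apply: measurable_without => A mA; exists A => //; rewrite setTI.
Qed.

Lemma measurable_count n j : Count n <> j ->
  measurable_fun setT (Defs.count src n : without j -> nat).
Proof.
by move=> /eqP; apply: measurable_without => A mA; exists A => //; rewrite setTI.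
Qed.

Lemma measurable_seed n k j : Seed n k <> j ->
  measurable_fun setT (seed src n k : without j -> S).
Proof.
by move=> /eqP; apply: measurable_without => A mA; exists A => //; rewrite setTI.
Qed.

Lemma measurable_coin n j : Coin n <> j ->
  measurable_fun setT (coin src n : without j -> R).
Proof.
by move=> /eqP; apply: measurable_without => A mA; exists A => //; rewrite setTI.
Qed.

Lemma measurable_fun_without j dV (V : measurableType dV) (f : W -> V) :
  measurable_fun setT (f : without j -> V) -> measurable_fun setT f.
Proof. exact: measurable_fun_others draw_events_measurable _ _ _ _. Qed.

Lemma integrate_draw j dV (V : measurableType dV) (L : probability V R)
    (Z : {mfun W >-> V}) (f : without j * V -> \bar R) :
  (forall A, measurable A -> draw_events j (Z @^-1` A)) ->
  (forall A, measurable A -> distribution P Z A = L A) ->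
  measurable_fun setT f -> (forall x, 0 <= f x)%E ->
  (\int[P]_w f (w, Z w) = \int[P]_w \int[L]_z f (w, z))%E.
Proof.
move=> ZG ZL mf f0; apply: integrate_out => //.
- exact: draw_events_measurable.
- exact: draw_eventsT.
- exact: draw_eventsI.
- exact: draws_independent.
Qed.

End DrawEvents.

Section ForsLaw.
Context {R : realType} d (W : measurableType d) (P : probability W R)
  dT (T : measurableType dT) (Q : probability T R)
  dS (S : measurableType dS) (K : probability S R) (B : R).
Variables (src : fors_source P Q K B) (est : T -> S -> R).
Hypothesis B_gt0 : 0 < B.
Hypothesis mest : measurable_fun setT (fun x : T * S => est x.1 x.2).
Hypothesis estB : forall y z, `|est y z| <= B.

Definition accept_factor (y : T) (z : S) : R := (B + est y z) / (2 * B).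

Lemma accept_factor_ge0 y z : 0 <= accept_factor y z.
Proof.
have := estB y z; rewrite ler_norml => /andP[h _].
by rewrite divr_ge0 ?mulr_ge0 ?(ltW B_gt0)//; lra.
Qed.

Lemma accept_factor_le1 y z : accept_factor y z <= 1.
Proof.
have := estB y z; rewrite ler_norml => /andP[_ h].
by rewrite ler_pdivrMr ?mulr_gt0//; lra.
Qed.

Lemma measurable_accept_factor :
  measurable_fun setT (fun x : T * S => accept_factor x.1 x.2).
Proof.
by apply: measurable_funM => //; exact: measurable_funD.
Qed.

(** The q(y) of the overview; [fine] loses nothing since the factor lies in [0, 1]. *)
Definition mean_factor (y : T) : R := fine (\int[K]_z (accept_factor y z)%:E).

Let mafy y : measurable_fun setT (EFin \o accept_factor y).
Proof.
apply/measurable_EFinP.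
exact: (measurableT_comp measurable_accept_factor (pair1_measurable y)).
Qed.

Let int_factor_ge0 y : (0 <= \int[K]_z (accept_factor y z)%:E)%E.
Proof. by apply: integral_ge0 => z _; rewrite lee_fin accept_factor_ge0. Qed.

Let int_factor_le1 y : (\int[K]_z (accept_factor y z)%:E <= 1)%E.
Proof.
apply: (@le_trans _ _ (\int[K]_z (cst 1 z))%E).
  apply: ge0_le_integral => //.
  - by move=> z _; rewrite lee_fin accept_factor_ge0.
  - exact: mafy.
  - by move=> z _; rewrite lee_fin accept_factor_le1.
by rewrite integral_cst//= mul1e probability_le1.
Qed.

Lemma mean_factorE y :
  (\int[K]_z (accept_factor y z)%:E = (mean_factor y)%:E)%E.
Proof.
rewrite fineK// ge0_fin_numE//.
by rewrite (le_lt_trans (int_factor_le1 y))// ltry.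
Qed.

Lemma mean_factor_ge0 y : 0 <= mean_factor y.
Proof. by rewrite -lee_fin -mean_factorE. Qed.

Lemma mean_factor_le1 y : mean_factor y <= 1.
Proof. by rewrite -lee_fin -mean_factorE. Qed.

Lemma measurable_mean_factor : measurable_fun setT mean_factor.
Proof.
apply: (measurableT_comp (fine_measurable measurableT)) => //.
apply: (measurable_fun_fubini_tonelli_F (fun x => (accept_factor x.1 x.2)%:E)).
- by apply/measurable_EFinP; exact: measurable_accept_factor.
- by move=> x; rewrite lee_fin accept_factor_ge0.
Qed.

(** Stated over an arbitrary space because it is applied to [without src j], where measurability
    records that [j] is not involved. *)
Lemma measurable_accept_prod dX (X : measurableType dX) (y : X -> T)
    (c : X -> nat) (z : nat -> X -> S) :
  measurable_fun setT y -> measurable_fun setT c ->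
  (forall k, measurable_fun setT (z k)) ->
  measurable_fun setT (fun x => \prod_(k < c x) accept_factor (y x) (z k x)).
Proof.
move=> my mc mz; apply: (@measurable_fun_nat_index _ _ _ _ c
  (fun k x => \prod_(i < k) accept_factor (y x) (z i x))) => // k.
apply: measurable_prod => i _.
exact: (measurableT_comp measurable_accept_factor (measurable_fun_pair my (mz i))).
Qed.

(** Acceptance in round [n] consults the draws of round [n] only, so a draw of any other round can
    be left out. *)
Lemma measurable_fors_accept n j : draw_round j != n ->
  measurable_fun setT ((fun w => fors_accept src est w n) : without src j -> bool).
Proof.
move=> jn; have nj i : draw_round i = n -> i <> j.
  by move=> i_n ij; move: jn; rewrite -ij i_n eqxx.
apply: (@measurable_fun_ler _ (without src j) _ setT (Defs.coin src n)).
  by apply: measurable_coin; exact: nj.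
apply: (@measurable_accept_prod _ (without src j) (proposal src n)
  (Defs.count src n) (seed src n)).
- by apply: measurable_proposal; exact: nj.
- by apply: measurable_count; exact: nj.
- by move=> k; apply: measurable_seed; exact: nj.
Qed.

Lemma fors_reachedS n w :
  fors_reached src est n.+1 w = fors_reached src est n w && ~~ fors_accept src est w n.
Proof.
apply/forallP/andP => [acc|[/forallP acc na] i].
  split; last exact: (acc ord_max).
  by apply/forallP => i; exact: (acc (widen_ord (leqnSn n) i)).
have [/= in_|] := ltnP i n; first exact: (acc (Ordinal in_)).
by move=> ni; have -> : i = n :> nat by apply/eqP; rewrite eqn_leq ni -ltnS ltn_ord.
Qed.

Lemma fors_reached0 w : fors_reached src est 0 w.
Proof. by apply/forallP => -[]. Qed.

(** Reaching round [n] is decided by the earlier rounds, so it involves no draw of round [n] or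
    later; this makes it independent of what happens in round [n]. *)
Lemma measurable_fors_reached n j : (n <= draw_round j)%N ->
  measurable_fun setT (fors_reached src est n : without src j -> bool).
Proof.
elim: n => [_|n IH nj].
  rewrite (_ : (fors_reached _ _ _ : _ -> bool) = cst true)//.
  by apply/funext => w; rewrite fors_reached0.
rewrite (_ : (fors_reached _ _ _ : _ -> bool) = fun w =>
  fors_reached src est n w && ~~ fors_accept src est w n); last first.
  by apply/funext => w; rewrite fors_reachedS.
have mr := IH (ltnW nj).
have ma : measurable_fun setT
    ((fun w => ~~ fors_accept src est w n) : without src j -> bool).
  by apply: measurable_neg; apply: measurable_fors_accept; rewrite gtn_eqF.
exact: measurable_and mr ma.
Qed.

Definition accept_rate (y : T) : R := expR (2 * B * (mean_factor y - 1)).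

Lemma measurable_accept_rate : measurable_fun setT accept_rate.
Proof.
apply: measurableT_comp => //; apply: measurable_funM => //.
by apply: measurable_funB => //; exact: measurable_mean_factor.
Qed.

Section Round.
(** [F] is a weight that involves no draw of round [n]; it will be the indicator that the round is
    reached. *)
Variables (n : nat) (F : W -> \bar R).
Hypothesis F0 : forall w, (0 <= F w)%E.
Hypothesis mF : forall j, draw_round j = n ->
  measurable_fun setT (F : without src j -> \bar R).

Let ap w := fors_accept_prob src est n w.

Let ap_ge0 w : 0 <= ap w.
Proof. by apply: prodr_ge0 => k _; exact: accept_factor_ge0. Qed.

Let ap_le1 w : ap w <= 1.
Proof.
have : 0 <= ap w <= 1; last by case/andP.
apply: (big_ind (fun x => 0 <= x <= 1)) => [|x y|k _].
- by rewrite ler01 lexx.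
- by move=> /andP[x0 x1] /andP[y0 y1]; rewrite mulr_ge0// mulr_ile1.
- by rewrite accept_factor_ge0 accept_factor_le1.
Qed.

Let map_ : measurable_fun setT (ap : without src (Coin n) -> R).
Proof.
apply: (@measurable_accept_prod _ (without src (Coin n)) (proposal src n)
  (Defs.count src n) (seed src n)).
- exact: measurable_proposal.
- exact: measurable_count.
- by move=> k; exact: measurable_seed.
Qed.

Let mfst dX dY (X : measurableType dX) (Y : measurableType dY) dV (V : measurableType dV)
  (f : X -> V) : measurable_fun setT f -> measurable_fun setT (fun x : X * Y => f x.1).
Proof. by move=> mf; exact: measurableT_comp mf measurable_fst. Qed.

Let msnd dX dY (X : measurableType dX) (Y : measurableType dY) dV (V : measurableType dV)
  (f : Y -> V) : measurable_fun setT f -> measurable_fun setT (fun x : X * Y => f x.2).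
Proof. by move=> mf; exact: measurableT_comp mf measurable_snd. Qed.

Lemma integrate_count :
  (\int[P]_w (F w * (Defs.count src n w)%:R%:E) = (\int[P]_w F w) * (2 * B)%:E)%E.
Proof.
rewrite (@integrate_draw _ _ _ _ _ _ _ _ _ _ _ src (Count n) _ _
  (poisson_prob (2 * B) 0) (Defs.count src n)
  (fun x => F x.1 * (x.2%:R : R)%:E)%E)/=.
- under eq_integral => w _.
    rewrite ge0_integralZl//; last first.
    rewrite poisson_mean ?mulr_gt0//.
    over.
  rewrite ge0_integralZr//.
  + exact: measurable_fun_without (mF (j := Count n) erefl).
  + by rewrite lee_fin mulr_ge0// ltW.
- by move=> A mA; exists A => //; rewrite setTI.
- by move=> A _; exact: count_law.
- apply: emeasurable_funM; first exact: (@mfst _ _ (without src (Count n)) _ _ _ _ (mF (j := Count n) erefl)).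
  apply/measurable_EFinP.
  have mnat : measurable_fun setT (fun k : nat => k%:R : R) by [].
  exact: (@msnd _ _ (without src (Count n)) _ _ _ _ mnat).
- by move=> x; rewrite mule_ge0.
Qed.

(** The number [M] of seeds is fixed here. The last seed is integrated out and its mean factor, a
    function of the proposal, is absorbed into [H]; hence the induction over all [H] that avoid the
    seeds of the round. *)
Let integrate_seeds M (H : W -> \bar R) : (forall w, 0 <= H w)%E ->
  (forall k, measurable_fun setT (H : without src (Seed n k) -> \bar R)) ->
  (\int[P]_w (H w *
     (\prod_(k < M) accept_factor (proposal src n w) (seed src n k w))%:E) =
   \int[P]_w (H w * (mean_factor (proposal src n w) ^+ M)%:E))%E.
Proof.
elim: M H => [|M IH] H H0 mH.
  by apply: eq_integral => w _; rewrite big_ord0 expr0.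
pose G w := (H w * (\prod_(k < M) accept_factor (proposal src n w) (seed src n k w))%:E)%E.
transitivity (\int[P]_w (G w * (accept_factor (proposal src n w) (seed src n M w))%:E))%E.
  by apply: eq_integral => w _; rewrite big_ord_recr/= EFinM muleA.
have mG : measurable_fun setT (G : without src (Seed n M) -> \bar R).
  apply: emeasurable_funM; first exact: mH.
  apply/measurable_EFinP/measurable_prod => i _.
  apply: (measurableT_comp measurable_accept_factor (measurable_fun_pair _ _)).
    exact: measurable_proposal.
  apply: measurable_seed => -[] /eqP; apply/negP.
  by rewrite neq_ltn ltn_ord.
have G0 w : (0 <= G w)%E.
  by rewrite mule_ge0// lee_fin prodr_ge0// => i _; exact: accept_factor_ge0.
rewrite (@integrate_draw _ _ _ _ _ _ _ _ _ _ _ src (Seed n M) _ _ K (seed src n M)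
  (fun x => G x.1 * (accept_factor (proposal src n x.1) x.2)%:E)%E)/=.
- under eq_integral => w _.
    rewrite ge0_integralZl//; last 2 first.
    + exact: mafy.
    + by move=> z _; rewrite lee_fin accept_factor_ge0.
    rewrite mean_factorE.
    over.
  transitivity (\int[P]_w ((H w * (mean_factor (proposal src n w))%:E) *
     (\prod_(k < M) accept_factor (proposal src n w) (seed src n k w))%:E))%E.
    by apply: eq_integral => w _; rewrite /G muleAC.
  rewrite IH.
  + by apply: eq_integral => w _; rewrite exprS EFinM muleA.
  + by move=> w; rewrite mule_ge0// lee_fin mean_factor_ge0.
  + move=> k; apply: emeasurable_funM; first exact: mH.
    apply/measurable_EFinP/(measurableT_comp measurable_mean_factor).
    exact: measurable_proposal.
- by move=> A mA; exists A => //; rewrite setTI.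
- by move=> A mA; exact: seed_law.
- apply: emeasurable_funM; first exact: mfst mG.
  apply/measurable_EFinP.
  apply: (measurableT_comp measurable_accept_factor (measurable_fun_pair _ measurable_snd)).
  apply: (mfst (f := proposal src n : without src (Seed n M) -> T)).
  exact: measurable_proposal.
- by move=> x; rewrite mule_ge0// lee_fin accept_factor_ge0.
Qed.

(* The draws of the round are integrated out in the order coin, seeds, count,
   proposal. *)
Lemma integrate_round (f : T -> \bar R) : measurable_fun setT f ->
  (forall y, 0 <= f y)%E ->
  (\int[P]_w (F w * f (proposal src n w) * (fors_accept src est w n)%:R%:E) =
   (\int[P]_w F w) * (\int[Q]_y (f y * (accept_rate y)%:E)))%E.
Proof.
move=> mf f0.
pose Fp w := (F w * f (proposal src n w))%E.
have Fp0 w : (0 <= Fp w)%E by rewrite mule_ge0.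
have mFp j : draw_round j = n -> Proposal n <> j ->
    measurable_fun setT (Fp : without src j -> \bar R).
  move=> jn pj; apply: emeasurable_funM; first exact: mF.
  by apply: (measurableT_comp mf); exact: measurable_proposal.
have mFpW : measurable_fun setT Fp.
  by apply: measurable_fun_without (mFp (Coin n) erefl _).
transitivity (\int[P]_w (Fp w * (ap w)%:E))%E.
  rewrite (@integrate_draw _ _ _ _ _ _ _ _ _ _ _ src (Coin n) _ _
    (@uniform01 R) (coin src n)
    (fun x => Fp x.1 * ((x.2 <= ap x.1)%R%:R : R)%:E)%E)/=.
  - apply: eq_integral => w _; rewrite ge0_integralZl//; last first.
      apply/measurable_EFinP/measurableT_comp => //.
      exact: measurable_fun_ler.
    by rewrite integral_uniform01_le// ap_ge0 ap_le1.
  - by move=> A mA; exists A => //; rewrite setTI.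
  - by move=> A mA; exact: coin_law.
  - apply: emeasurable_funM; first exact: (@mfst _ _ (without src (Coin n)) _ _ _ _ (mFp (Coin n) erefl _)).
    apply/measurable_EFinP/measurableT_comp => //; apply: measurable_fun_ler.
      exact: measurable_snd.
    exact: (@mfst _ _ (without src (Coin n)) _ _ _ _ map_).
  - by move=> x; rewrite mule_ge0.
pose pr k w := \prod_(i < k) accept_factor (proposal src n w) (seed src n i w).
have pr0 k w : 0 <= pr k w.
  by apply: prodr_ge0 => i _; exact: accept_factor_ge0.
have mpr k j : Proposal n <> j -> (forall i, Seed n i <> j) ->
    measurable_fun setT (pr k : without src j -> R).
  move=> pj sj; apply: (@measurable_accept_prod _ (without src j) (proposal src n)
    (cst k) (seed src n)) => //.
  - exact: measurable_proposal.
  - by move=> i; exact: measurable_seed.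
have mFpr j : draw_round j = n -> Proposal n <> j -> (forall i, Seed n i <> j) ->
    measurable_fun setT ((fun x => (Fp x.1 * (pr x.2 x.1)%:E)%E) : without src j * nat -> \bar R).
  move=> jn pj sj; apply: emeasurable_funM; first exact: (@mfst _ _ (without src j) _ _ _ _ (mFp j jn pj)).
  apply/measurable_EFinP.
  exact: (@measurable_fun_nat_index _ _ _ _ (fun x : without src j * nat => x.2)
    (fun k x => pr k x.1) measurable_snd
    (fun k => @mfst _ _ (without src j) nat _ _ _ (mpr k j pj sj))).
transitivity (\int[P]_w (Fp w * (accept_rate (proposal src n w))%:E))%E.
  rewrite (@integrate_draw _ _ _ _ _ _ _ _ _ _ _ src (Count n) _ _
    (poisson_prob (2 * B) 0) (Defs.count src n)
    (fun x => Fp x.1 * (pr x.2 x.1)%:E)%E)/=.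
  - have mW : measurable_fun setT (fun x : W * nat => (Fp x.1 * (pr x.2 x.1)%:E)%E).
      apply: emeasurable_funM; first exact: mfst.
      apply/measurable_EFinP.
      apply: (@measurable_fun_nat_index _ _ _ _ snd (fun k x => pr k x.1)) => // k.
      apply: mfst; apply: measurable_fun_without (mpr k (Coin n) _ _) => //.
    (* Seeds can be integrated out only for a fixed number of them: Tonelli moves the count outside,
       and a second exchange brings it back inside, where [poisson_pgf] sums over it. *)
    rewrite (fubini_tonelli (m1 := P) (m2 := poisson_prob (2 * B) 0)
      (fun x : W * nat => (Fp x.1 * (pr x.2 x.1)%:E)%E))//=; last first.
      by move=> x; rewrite mule_ge0// lee_fin.
    under eq_integral => k _.
      rewrite integrate_seeds//; last by move=> i; exact: mFp.
      over.
    have mq : measurable_fun setT (fun w => mean_factor (proposal src n w)).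
      exact: (measurableT_comp measurable_mean_factor).
    rewrite -(fubini_tonelli (m1 := P) (m2 := poisson_prob (2 * B) 0)
      (fun x : W * nat => (Fp x.1 * (mean_factor (proposal src n x.1) ^+ x.2)%:E)%E))//=.
    + apply: eq_integral => w _; rewrite ge0_integralZl//; last first.
        by move=> k _; rewrite lee_fin exprn_ge0// mean_factor_ge0.
      by rewrite poisson_pgf ?mulr_gt0// mean_factor_ge0.
    + apply: emeasurable_funM; first exact: mfst.
      apply/measurable_EFinP.
      apply: (@measurable_fun_nat_index _ _ _ _ snd
        (fun k x => mean_factor (proposal src n x.1) ^+ k)) => // k.
      have mq1 : measurable_fun setT
          (fun x : W * nat => mean_factor (proposal src n x.1)) := mfst mq.
      exact: measurable_funX.
    + by move=> x; rewrite mule_ge0// lee_fin exprn_ge0// mean_factor_ge0.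
  - by move=> A mA; exists A => //; rewrite setTI.
  - by move=> A _; exact: count_law.
  - exact: mFpr.
  - by move=> x; rewrite mule_ge0// lee_fin.
have mr : measurable_fun setT (fun y => f y * (accept_rate y)%:E)%E.
  by apply: emeasurable_funM => //; apply/measurable_EFinP; exact: measurable_accept_rate.
have r0 y : (0 <= f y * (accept_rate y)%:E)%E.
  by rewrite mule_ge0// lee_fin expR_ge0.
under eq_integral do rewrite /Fp -muleA.
rewrite (@integrate_draw _ _ _ _ _ _ _ _ _ _ _ src (Proposal n) _ _ Q (proposal src n)
    (fun x => F x.1 * (f x.2 * (accept_rate x.2)%:E))%E)/=.
- under eq_integral do rewrite ge0_integralZl//.
  rewrite ge0_integralZr//; last by rewrite integral_ge0.
  exact: measurable_fun_without (mF (j := Coin n) erefl).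
- by move=> A mA; exists A => //; rewrite setTI.
- by move=> A mA; exact: proposal_law.
- apply: emeasurable_funM; first exact: (@mfst _ _ (without src (Proposal n)) _ _ _ _ (mF (j := Proposal n) erefl)).
  exact: (@msnd _ _ (without src (Proposal n)) _ _ _ _ mr).
- by move=> x; rewrite mule_ge0.
Qed.

End Round.

Let mbool dX (X : measurableType dX) (f : X -> bool) : measurable_fun setT f ->
  measurable_fun setT (fun x => ((f x)%:R : R)%:E).
Proof.
move=> mf; apply/measurable_EFinP.
have mb : measurable_fun setT (fun b : bool => b%:R : R) by [].
exact: (measurableT_comp mb mf).
Qed.

Let reachedR n w : \bar R := ((fors_reached src est n w)%:R : R)%:E.

Let reachedR_ge0 n w : (0 <= reachedR n w)%E.
Proof. by rewrite lee_fin ler0n. Qed.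

Let measurable_reachedR n j : (n <= draw_round j)%N ->
  measurable_fun setT (reachedR n : without src j -> \bar R).
Proof. by move=> nj; exact: mbool (measurable_fors_reached nj). Qed.

Let measurable_reachedRW n : measurable_fun setT (reachedR n).
Proof.
exact: measurable_fun_without (@measurable_reachedR n (Coin n) (leqnn n)).
Qed.

Lemma accept_rate_le1 y : accept_rate y <= 1.
Proof.
rewrite -expR0 ler_expR pmulr_rle0 ?mulr_gt0// subr_le0.
exact: mean_factor_le1.
Qed.

Lemma accept_rate_ge y : expR (- (2 * B)) <= accept_rate y.
Proof.
rewrite /accept_rate ler_expR.
by have := mulr_ge0 (ltW B_gt0) (mean_factor_ge0 y); lra.
Qed.

Let measurable_accept_rateE : measurable_fun setT (EFin \o accept_rate).
Proof. by apply/measurable_EFinP; exact: measurable_accept_rate. Qed.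

(** The probability that a round, once reached, accepts. *)
Definition acceptance : R := fine (\int[Q]_y (accept_rate y)%:E).

Lemma acceptanceE : (\int[Q]_y (accept_rate y)%:E = acceptance%:E)%E.
Proof.
have le1 : (\int[Q]_y (accept_rate y)%:E <= 1)%E.
  apply: (@le_trans _ _ (\int[Q]_y (cst 1 y))%E).
    apply: ge0_le_integral => //.
    - by move=> y _; rewrite lee_fin expR_ge0.
    - by move=> y _; rewrite lee_fin accept_rate_le1.
  by rewrite integral_cst//= mul1e probability_le1.
rewrite fineK// ge0_fin_numE ?(le_lt_trans le1) ?ltry//.
by apply: integral_ge0 => y _; rewrite lee_fin expR_ge0.
Qed.

Lemma acceptance_ge : expR (- (2 * B)) <= acceptance.
Proof.
rewrite -lee_fin -acceptanceE.
apply: (@le_trans _ _ (\int[Q]_y (cst (expR (- (2 * B)))%:E y))%E).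
  by rewrite integral_cst//= probability_setT mule1.
by apply: ge0_le_integral => // y _; rewrite /= lee_fin ?accept_rate_ge ?expR_ge0.
Qed.

Lemma acceptance_gt0 : 0 < acceptance.
Proof. exact: lt_le_trans (expR_gt0 _) acceptance_ge. Qed.

Lemma acceptance_le1 : acceptance <= 1.
Proof.
rewrite -lee_fin -acceptanceE.
apply: (@le_trans _ _ (\int[Q]_y (cst 1 y))%E).
  apply: ge0_le_integral => //.
  - by move=> y _; rewrite lee_fin expR_ge0.
  - by move=> y _; rewrite lee_fin accept_rate_le1.
by rewrite integral_cst//= mul1e probability_le1.
Qed.

(** Reaching round n splits into reaching round n + 1 and accepting in round n; by [integrate_round]
    with f = 1 the latter takes the fraction [acceptance]. *)
Lemma integral_reached n :
  (\int[P]_w ((fors_reached src est n w)%:R : R)%:E = ((1 - acceptance) ^+ n)%:E)%E.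
Proof.
elim: n => [|n IH].
  under eq_integral do rewrite fors_reached0.
  by rewrite integral_cst//= probability_setT mule1 expr0.
have mfin : measurable_fun setT (fun w => fors_accept src est w n).
  apply: measurable_fun_without (@measurable_fors_accept n (Coin n.+1) _).
  by rewrite /= gtn_eqF.
pose f2 w := (reachedR n w * cst 1%E (proposal src n w) *
  ((fors_accept src est w n)%:R : R)%:E)%E.
have f20 w : (0 <= f2 w)%E by rewrite !mule_ge0.
have mf2 : measurable_fun setT f2.
  by rewrite /f2; under eq_fun do rewrite mule1; exact: emeasurable_funM (mbool mfin).
have : (\int[P]_w reachedR n w = \int[P]_w reachedR n.+1 w + \int[P]_w f2 w)%E.
  rewrite -ge0_integralD//.
  apply: eq_integral => w _; rewrite /f2 /reachedR fors_reachedS /=.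
  case: (fors_reached src est n w); case: (fors_accept src est w n) => /=;
    by rewrite -?EFinM -?EFinD ?mulr1 ?mul0r ?mulr0 ?addr0 ?add0r.
rewrite /f2 (@integrate_round n (reachedR n) _ _ (cst 1%E))//; last first.
  by move=> j jn; apply: measurable_reachedR; rewrite jn.
under [X in (_ + _ * X)%E]eq_integral do rewrite /= mul1e.
rewrite acceptanceE IH -/(reachedR n.+1).
case: (\int[P]_w reachedR n.+1 w)%E => [x| |]//= [E].
by congr EFin; rewrite exprS; lra.
Qed.

Lemma geometric_nneseries (z : R) : 0 <= z < 1 ->
  (\sum_(n <oo) (z ^+ n)%:E = ((1 - z)^-1)%:E)%E.
Proof.
move=> /andP[z0 z1].
have z1' : `|z| < 1 by rewrite ger0_norm.
have cz := @cvg_geometric_series R 1 z z1'.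
transitivity (limn (EFin \o series (geometric 1 z))).
  apply/congr_lim/funext => n /=; rewrite /series/= -sumEFin.
  by apply: eq_bigr => k _; rewrite mul1r.
by rewrite EFin_lim; [rewrite (cvg_lim _ cz)// div1r|exact: cvgP cz].
Qed.

Let rejection01 : 0 <= 1 - acceptance < 1.
Proof. by rewrite subr_ge0 acceptance_le1 gtrBl acceptance_gt0. Qed.

Lemma measurable_fors_proposal_calls :
  measurable_fun setT (fors_proposal_calls src est).
Proof.
apply: ge0_emeasurable_sum => [n w _|n _]; first by case: ifP.
rewrite (_ : (fun w => _) = reachedR n)//.
by apply/funext => w; rewrite /reachedR; case: ifP.
Qed.

Lemma fors_proposal_calls_ge0 w : (0 <= fors_proposal_calls src est w)%E.
Proof. by apply: nneseries_ge0 => n _ _; case: ifP. Qed.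

Lemma measurable_fors_estimator_calls :
  measurable_fun setT (fors_estimator_calls src est).
Proof.
apply: ge0_emeasurable_sum => [n w _|n _]; first by case: ifP.
rewrite (_ : (fun w => _) =
    fun w => (reachedR n w * ((Defs.count src n w)%:R : R)%:E)%E).
  apply: emeasurable_funM => //; apply/measurable_EFinP.
  have mnat : measurable_fun setT (fun k : nat => k%:R : R) by [].
  exact: (measurableT_comp mnat).
by apply/funext => w; rewrite /reachedR; case: ifP => _; rewrite ?mul1e ?mul0e.
Qed.

Lemma fors_estimator_calls_ge0 w : (0 <= fors_estimator_calls src est w)%E.
Proof. by apply: nneseries_ge0 => n _ _; case: ifP. Qed.

Lemma expected_proposal_calls :
  (\int[P]_w fors_proposal_calls src est w = (acceptance^-1)%:E)%E.
Proof.
transitivity (\int[P]_w \sum_(n <oo) reachedR n w)%E.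
  apply: eq_integral => w _; apply: eq_eseriesr => n _.
  by rewrite /reachedR; case: ifP.
rewrite integral_nneseries//.
under eq_eseriesr do rewrite integral_reached.
by rewrite geometric_nneseries// opprB addrCA subrr addr0.
Qed.

(** Wald's identity: the count of round n is independent of reaching it, so each reached round
    contributes 2 B on average. *)
Lemma expected_estimator_calls :
  (\int[P]_w fors_estimator_calls src est w = (2 * B / acceptance)%:E)%E.
Proof.
have mc n : measurable_fun setT (fun w => ((Defs.count src n w)%:R : R)%:E).
  apply/measurable_EFinP.
  have mnat : measurable_fun setT (fun k : nat => k%:R : R) by [].
  exact: (measurableT_comp mnat).
transitivity (\int[P]_w \sum_(n <oo)
    (reachedR n w * ((Defs.count src n w)%:R : R)%:E))%E.
  apply: eq_integral => w _; apply: eq_eseriesr => n _.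
  by rewrite /reachedR; case: ifP => _; rewrite ?mul1e ?mul0e.
rewrite integral_nneseries//; last 2 first.
- by move=> n; apply: emeasurable_funM.
- by move=> n w _; rewrite mule_ge0.
transitivity (\sum_(n <oo) ((2 * B)%:E * ((1 - acceptance) ^+ n)%:E))%E.
  apply: eq_eseriesr => n _; rewrite (integrate_count (n := n) (F := reachedR n))//.
    by rewrite integral_reached muleC.
  by move=> j jn; apply: measurable_reachedR; rewrite jn.
rewrite nneseriesZl; last first.
  by move=> n _; rewrite lee_fin exprn_ge0//; case/andP: rejection01.
by rewrite geometric_nneseries// opprB addrCA subrr addr0.
Qed.

(** Non-termination, where [fors_output] takes a default value. It lies in every event of reaching
    round n, and these have geometrically decaying probability. *)
Let never : set W := [set w | forall n, fors_reached src est n w].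

Let measurable_reached_set n : measurable [set w | fors_reached src est n w].
Proof.
have mr := measurable_fun_without (@measurable_fors_reached n (Coin n) (leqnn n)).
have := mr measurableT [set true] I; rewrite setTI.
by rewrite (_ : _ @^-1` _ = [set w | fors_reached src est n w]).
Qed.

Let measurable_accept_set n : measurable [set w | fors_accept src est w n].
Proof.
have ma := measurable_fun_without (@measurable_fors_accept n (Coin n.+1) (negbT (gtn_eqF (ltnSn n)))).
have := ma measurableT [set true] I; rewrite setTI.
by rewrite (_ : _ @^-1` _ = [set w | fors_accept src est w n]).
Qed.

Let measurable_never : measurable never.
Proof.
rewrite (_ : never = \bigcap_n [set w | fors_reached src est n w]).
  exact: bigcapT_measurable.
by apply/seteqP; split => [w nw n _|w nw n]; [exact: nw|exact: nw n I].
Qed.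

Let never0 : P never = 0%E.
Proof.
have le_n n : fine (P never) <= (1 - acceptance) ^+ n.
  rewrite -lee_fin fineK ?fin_num_measure// -integral_reached.
  rewrite (_ : (\int[P]_w _)%E = P [set w | fors_reached src est n w]).
    by apply: le_measure; rewrite ?inE// => w; exact.
  rewrite -[X in _ = P X]setIT -integral_indic//.
  by apply: eq_integral => w _; rewrite indicE mem_setE.
apply/eqP; rewrite eq_le measure_ge0 andbT -(@fineK _ (P never)) ?fin_num_measure//.
have [z0 z1] := andP rejection01.
have z1' : `|1 - acceptance| < 1 by rewrite ger0_norm.
have cz := @cvg_geometric R 1 (1 - acceptance) z1'.
rewrite lee_fin -(cvg_lim (@Rhausdorff R) cz).
apply: limr_ge; first exact: cvgP cz.
by apply: nearW => n; rewrite /geometric/= mul1r.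
Qed.

(** The first accepting round is unique, so these events are disjoint in [n]; they cover the
    preimage of [A] up to [never]. *)
Let output_at (A : set T) n : set W :=
  [set w | fors_reached src est n w] `&` [set w | fors_accept src est w n]
  `&` proposal src n @^-1` A.

Let measurable_output_at A n : measurable A -> measurable (output_at A n).
Proof.
move=> mA; apply: measurableI; first exact: measurableI.
by rewrite -[X in measurable X]setTI; exact: measurable_funP.
Qed.

Let output_preimage A : fors_output src est @^-1` A =
  \bigcup_n output_at A n `|` (never `&` [set _ | A point]).
Proof.
apply/seteqP; split => w; rewrite /= /fors_output.
  case: pselect => [ex|nex] Aw; last first.
    right; split => // n; apply/forallP => i; apply/negP => acc.
    by apply: nex; exists i.
  left; exists (ex_minn ex) => //; move: Aw; case: ex_minnP => n acc min_n Aw.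
  split => //; split => //; apply/forallP => i; apply/negP => /min_n.
  by rewrite leqNgt ltn_ord.
case: pselect => [ex|nex].
  case: ex_minnP => m acc min_m [[n _ [[/= /forallP rn an] An]]|[nw _]]; last first.
    by have /forallP/(_ ord_max) := nw m.+1; rewrite /= acc.
  suff -> : m = n by [].
  apply/eqP; rewrite eqn_leq min_m//= leqNgt; apply/negP => mn.
  by have := rn (Ordinal mn); rewrite /= acc.
by move=> [[n _ [[_ /= an] _]]|[_ Ap]//]; case: nex; exists n.
Qed.

(** Stopping in round n with a proposal in [A] has probability (1 - acceptance)^n times the integral
    of the rate over [A]; the geometric series in n produces the normalising factor. *)
Lemma fors_output_law (A : set T) : measurable A ->
  (P (fors_output src est @^-1` A) =
   \int[Q]_(y in A) (accept_rate y)%:E * (acceptance^-1)%:E)%E.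
Proof.
move=> mA; rewrite output_preimage measureU0//; last 3 first.
- by apply: bigcup_measurable => n _; exact: measurable_output_at.
- apply: measurableI => //; have [Ap|nAp] := pselect (A point).
    by rewrite (_ : [set _ | _] = setT)//; apply/seteqP; split.
  by rewrite (_ : [set _ | _] = set0)//; apply/seteqP; split.
- apply/eqP; rewrite eq_le measure_ge0 andbT -never0.
  apply: le_measure; rewrite ?inE//; apply: measurableI => //.
  have [Ap|nAp] := pselect (A point).
    by rewrite (_ : [set _ | _] = setT)//; apply/seteqP; split.
  by rewrite (_ : [set _ | _] = set0)//; apply/seteqP; split.
rewrite measure_bigcup//; last 2 first.
- by move=> n _; exact: measurable_output_at.
- move=> m n _ _ [w [[[/= /forallP rm am] _] [[/= /forallP rn an] _]]].
  case: (ltngtP m n) => // lt_mn.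
    by have := rn (Ordinal lt_mn); rewrite /= am.
  by have := rm (Ordinal lt_mn); rewrite /= an.
rewrite (eq_eseriesl (Q := xpredT)); last by move=> n; rewrite in_setT.
transitivity (\sum_(n <oo) ((\int[Q]_(y in A) (accept_rate y)%:E) *
    ((1 - acceptance) ^+ n)%:E))%E.
  apply: eq_eseriesr => n _.
  transitivity (\int[P]_w (\1_(output_at A n) w)%:E)%E.
    by rewrite integral_indic// ?setIT//; exact: measurable_output_at.
  transitivity (\int[P]_w (reachedR n w * (\1_A (proposal src n w))%:E *
      (fors_accept src est w n)%:R%:E))%E.
    apply: eq_integral => w _; rewrite -!EFinM; congr EFin.
    rewrite !indicE (_ : (w \in output_at A n) = [&& fors_reached src est n w,
      fors_accept src est w n & proposal src n w \in A]).
      by case: (fors_reached src est n w); case: (fors_accept src est w n);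
        case: (proposal src n w \in A); rewrite /= ?mulr1 ?mulr0 ?mul0r.
    apply/idP/and3P => [/set_mem [[r a] Aw]|[r a Aw]].
      by split => //; exact: mem_set.
    by apply/mem_set; split => //; exact: set_mem Aw.
  rewrite (@integrate_round n (reachedR n) _ _ (fun y => (\1_A y)%:E))//.
  - rewrite integral_reached muleC; congr (_ * _)%E.
    rewrite [RHS]integral_mkcond; apply: eq_integral => y _.
    by rewrite patchE indicE; case: ifP; rewrite ?mul1e ?mul0e.
  - by move=> j jn; apply: measurable_reachedR; rewrite jn.
  - by apply/measurable_EFinP; exact: measurable_indic.
have rfin : (\int[Q]_(y in A) (accept_rate y)%:E)%E \is a fin_num.
  rewrite ge0_fin_numE; last first.
    by apply: integral_ge0 => y _; rewrite lee_fin expR_ge0.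
  rewrite (@le_lt_trans _ _ acceptance%:E) ?ltry// -acceptanceE.
  apply: ge0_subset_integral => // y _.
  by rewrite lee_fin expR_ge0.
rewrite -(fineK rfin) nneseriesZl; last first.
  by move=> n _; rewrite lee_fin exprn_ge0//; case/andP: rejection01.
by rewrite geometric_nneseries// opprB addrCA subrr addr0.
Qed.

End ForsLaw.

(** * Gaussian vectors *)

Section VectorMeasurability.
Context {R : realType} {m : nat}.
Implicit Types u v : m.-tuple R.

Lemma measurable_dotp d (X : measurableType d) (f g : X -> m.-tuple R) :
  measurable_fun setT f -> measurable_fun setT g ->
  measurable_fun setT (fun x => dotp (f x) (g x)).
Proof.
move=> mf mg; apply: measurable_sum => i; apply: measurable_funM.
- exact: (measurableT_comp (measurable_tnth i) mf).
- exact: (measurableT_comp (measurable_tnth i) mg).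
Qed.

Lemma measurable_vsub d (X : measurableType d) (f g : X -> m.-tuple R) :
  measurable_fun setT f -> measurable_fun setT g ->
  measurable_fun setT (fun x => vsub (f x) (g x)).
Proof.
move=> mf mg; apply/measurable_fun_tnthP => i.
rewrite (_ : _ \o _ = fun x => tnth (f x) i - tnth (g x) i); last first.
  by apply/funext => x; rewrite /= tnth_mktuple.
apply: measurable_funB.
- exact: (measurableT_comp (measurable_tnth i) mf).
- exact: (measurableT_comp (measurable_tnth i) mg).
Qed.

Definition vscale (t : R) u : m.-tuple R := [tuple t * tnth u i | i < m].

Lemma dotpZl t u v : dotp (vscale t u) v = t * dotp u v.
Proof.
by rewrite /dotp mulr_sumr; apply: eq_bigr => i _; rewrite tnth_mktuple mulrA.
Qed.

Lemma dotpC u v : dotp u v = dotp v u.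
Proof. by apply: eq_bigr => i _; rewrite mulrC. Qed.

Lemma dotpDl u v w : dotp (vadd u v) w = dotp u w + dotp v w.
Proof.
by rewrite /dotp -big_split/=; apply: eq_bigr => i _; rewrite tnth_mktuple mulrDl.
Qed.

Lemma dotpBl u v w : dotp (vsub u v) w = dotp u w - dotp v w.
Proof.
by rewrite /dotp -sumrB; apply: eq_bigr => i _; rewrite tnth_mktuple mulrBl.
Qed.

Lemma dotpp_ge0 u : 0 <= dotp u u.
Proof. by apply: sumr_ge0 => i _; rewrite -expr2 sqr_ge0. Qed.

Lemma enorm_ge0 u : 0 <= enorm u. Proof. exact: sqrtr_ge0. Qed.

Lemma sqr_enorm u : enorm u ^+ 2 = dotp u u.
Proof. by rewrite sqr_sqrtr// dotpp_ge0. Qed.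

End VectorMeasurability.

(** * Exponential tilts and generating functions of a Gaussian vector *)

Section GaussianTilt.
Context {R : realType}.
Local Open Scope ereal_scope.

Lemma integral_normal_prob (m : R) (f : measurableTypeR R -> \bar R) :
  measurable_fun setT f -> (forall x, 0 <= f x) ->
  \int[normal_prob m 1]_x f x =
  \int[lebesgue_measure]_x (f x * (normal_pdf m 1 x)%:E).
Proof.
move=> mf f0; apply: ge0_integral_density => //.
- exact: measurable_normal_pdf.
- by move=> x; exact: normal_pdf_ge0.
Qed.

(** The same law on two carriers of the real line; the identity map transports one to the other. *)
Lemma integral_normal1 (m : R) (f : R -> \bar R) :
  measurable_fun setT f -> (forall x, 0 <= f x) ->
  \int[normal1 m]_x f x = \int[normal_prob m 1]_x f x.
Proof.
move=> mf f0.
pose idR : measurableTypeR R -> R := idfun.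
have mid : measurable_fun setT idR by move=> _ A mA; rewrite setTI.
transitivity (\int[pushforward (normal_prob m 1) idR]_x f x).
  exact: eq_measure_integral.
by rewrite ge0_integral_pushforward.
Qed.

(** Completing the square: (x - m - a)^2 = (x - m)^2 - 2 a (x - m) + a^2. *)
Lemma normal1_tilt (m a : R) (f : R -> \bar R) :
  measurable_fun setT f -> (forall x, 0 <= f x) ->
  \int[normal1 (m + a)]_x f x =
  \int[normal1 m]_x (f x * (expR (a * (x - m) - a ^+ 2 / 2))%:E).
Proof.
move=> mf f0.
have mft : measurable_fun setT
    (fun x => f x * (expR (a * (x - m) - a ^+ 2 / 2))%:E).
  apply: emeasurable_funM => //; apply/measurable_EFinP.
  apply: measurableT_comp => //; apply: measurable_funB => //.
  by apply: measurable_funM => //; exact: measurable_funB.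
have ft0 x : 0 <= f x * (expR (a * (x - m) - a ^+ 2 / 2))%:E.
  by rewrite mule_ge0// lee_fin expR_ge0.
transitivity (\int[normal_prob (m + a) 1]_x f x); first exact: integral_normal1.
transitivity (\int[normal_prob m 1]_x (f x * (expR (a * (x - m) - a ^+ 2 / 2))%:E));
  last exact/esym/(integral_normal1 m mft ft0).
rewrite (@integral_normal_prob (m + a) f mf f0) (@integral_normal_prob m _ mft ft0).
apply: eq_integral => x _; rewrite -muleA -EFinM; congr (_ * _%:E).
rewrite !normal_pdfE ?oner_neq0// mulrCA; congr (_ * _)%R.
rewrite /normal_fun -expRD; congr expR.
by rewrite expr1n mulr2n; field.
Qed.

Lemma measurable_tuple_cons2 n (x : R) :
  measurable_fun setT (fun y : n.-tuple R => tuple_cons (x, y)).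
Proof.
have mc : measurable_fun setT (@tuple_cons R n) by exact: measurable_cons.
exact: (measurableT_comp mc (pair1_measurable x)).
Qed.

Lemma integral_gaussianS n (mu : n.+1.-tuple R) (f : n.+1.-tuple R -> \bar R) :
  measurable_fun setT f -> (forall x, 0 <= f x) ->
  \int[gaussian mu]_y f y =
  \int[normal1 (thead mu)]_x \int[gaussian [tuple of behead mu]]_y
     f (tuple_cons (x, y)).
Proof.
move=> mf f0.
transitivity (\int[prod_prob (normal1 (thead mu)) (gaussian [tuple of behead mu])]_z
  f (tuple_cons z)).
  by rewrite /= /distribution ge0_integral_pushforward.
rewrite -(fubini_tonelli1 (m1 := normal1 (thead mu))
  (m2 := gaussian [tuple of behead mu]) (fun z => f (tuple_cons z)))//.
exact: measurableT_comp.
Qed.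

Lemma measurable_tilt n (mu a : n.-tuple R) :
  measurable_fun setT (fun y => expR (dotp a (vsub y mu) - dotp a a / 2)).
Proof.
apply: measurableT_comp => //; apply: measurable_funB => //.
by apply: measurable_dotp => //; exact: measurable_vsub.
Qed.

Lemma tnth_lift0 n (u : n.+1.-tuple R) (i : 'I_n) :
  tnth u (lift ord0 i) = tnth [tuple of behead u] i.
Proof. by rewrite [in LHS](tuple_eta u) tnthS. Qed.

Lemma dotp_recl n (u v : n.+1.-tuple R) :
  dotp u v = (thead u * thead v + dotp [tuple of behead u] [tuple of behead v])%R.
Proof.
by rewrite /dotp big_ord_recl; congr (_ + _)%R; apply: eq_bigr => i _;
  rewrite !tnth_lift0.
Qed.

(** The Cameron-Martin formula in finite dimension. Law and exponent both split into first
    coordinate and tail, handled by [normal1_tilt] and the induction hypothesis. *)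
Lemma gaussian_tilt n (mu a : n.-tuple R) (f : n.-tuple R -> \bar R) :
  measurable_fun setT f -> (forall x, 0 <= f x) ->
  \int[gaussian (vadd mu a)]_y f y =
  \int[gaussian mu]_y (f y * (expR (dotp a (vsub y mu) - dotp a a / 2))%:E).
Proof.
elim: n mu a f => [|n IH] mu a f mf f0.
  rewrite /= !integral_dirac//; last first.
    by apply: emeasurable_funM => //; apply/measurable_EFinP; exact: measurable_tilt.
  rewrite !diracT !mul1e /dotp !big_ord0 mul0r subr0 expR0 mule1.
  by rewrite (tuple0 mu) (tuple0 (vadd _ _)).
have mt := measurable_tilt [tuple of behead mu] [tuple of behead a].
have mft : measurable_fun setT
    (fun y => f y * (expR (dotp a (vsub y mu) - dotp a a / 2))%:E).
  by apply: emeasurable_funM => //; apply/measurable_EFinP; exact: measurable_tilt.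
have ft0 y : 0 <= f y * (expR (dotp a (vsub y mu) - dotp a a / 2))%:E.
  by rewrite mule_ge0// lee_fin expR_ge0.
apply: (etrans (@integral_gaussianS _ (vadd mu a) f mf f0)).
apply/esym; apply: (etrans (@integral_gaussianS _ mu _ mft ft0)); apply/esym.
have -> : thead (vadd mu a) = (thead mu + thead a)%R by rewrite /thead tnth_mktuple.
have -> : [tuple of behead (vadd mu a)] =
    vadd [tuple of behead mu] [tuple of behead a].
  by apply: eq_from_tnth => i; rewrite -tnth_lift0 !tnth_mktuple !tnth_lift0.
have mfx x : measurable_fun setT (fun y : n.-tuple R => f (tuple_cons (x, y))).
  exact: measurableT_comp mf (measurable_tuple_cons2 x).
under eq_integral do rewrite IH//.
pose tl (y : n.-tuple R) := expR (dotp [tuple of behead a] (vsub y [tuple of behead mu]) -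
  dotp [tuple of behead a] [tuple of behead a] / 2).
have tl0 y : (0 <= tl y)%R by exact: expR_ge0.
have mftl x : measurable_fun setT (fun y => f (tuple_cons (x, y)) * (tl y)%:E).
  by apply: emeasurable_funM => //; apply/measurable_EFinP; exact: mt.
have mI : measurable_fun setT (fun x : R =>
    \int[gaussian [tuple of behead mu]]_y (f (tuple_cons (x, y)) * (tl y)%:E)).
  apply: (measurable_fun_fubini_tonelli_F
    (fun z : R * n.-tuple R => f (tuple_cons z) * (tl z.2)%:E)).
    apply: emeasurable_funM; first exact: measurableT_comp.
    by apply/measurable_EFinP; exact: (measurableT_comp mt measurable_snd).
  by move=> z; rewrite mule_ge0// lee_fin.
rewrite normal1_tilt//; last first.
  by move=> x; apply: integral_ge0 => y _; rewrite mule_ge0// lee_fin.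
apply: eq_integral => x _; rewrite -ge0_integralZr//; last first.
  by move=> y _; rewrite mule_ge0// lee_fin expR_ge0.
apply: eq_integral => y _; rewrite -muleA -EFinM; congr (_ * _%:E).
rewrite -expRD; congr expR.
rewrite (dotp_recl a a) (dotp_recl a (vsub _ _)).
have -> : thead (vsub (tuple_cons (x, y)) mu) = (x - thead mu)%R.
  by rewrite /thead tnth_mktuple.
have -> : [tuple of behead (vsub (tuple_cons (x, y)) mu)] =
    vsub y [tuple of behead mu].
  apply: eq_from_tnth => i; rewrite -tnth_lift0 !tnth_mktuple !tnth_lift0.
  by congr (tnth _ _ - _)%R; apply: val_inj.
by field.
Qed.

Lemma measurable_gaussian_exponent n (mu a : n.-tuple R) :
  measurable_fun setT (fun y => dotp a (vsub y mu)).
Proof. by apply: measurable_dotp => //; exact: measurable_vsub. Qed.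

(** Apply [gaussian_tilt] to the constant 1: the shifted law has total mass one. *)
Lemma gaussian_mgf n (mu a : n.-tuple R) :
  \int[gaussian mu]_y (expR (dotp a (vsub y mu)))%:E = (expR (dotp a a / 2))%:E.
Proof.
have me : measurable_fun setT (fun y => (expR (dotp a (vsub y mu)))%:E).
  apply/measurable_EFinP/measurableT_comp => //.
  exact: measurable_gaussian_exponent.
have e0 y : 0 <= (expR (dotp a (vsub y mu)))%:E by rewrite lee_fin expR_ge0.
have : \int[gaussian (vadd mu a)]_y (cst 1 y) = 1.
  by rewrite integral_cst//= mul1e probability_setT.
rewrite gaussian_tilt//=.
under eq_integral do rewrite mul1e expRD EFinM.
rewrite ge0_integralZr//.
have : 0 <= \int[gaussian mu]_y (expR (dotp a (vsub y mu)))%:E.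
  exact: integral_ge0.
(* An infinite value is excluded, since its product with a positive constant would not be 1. *)
move: (\int[gaussian mu]_y (expR (dotp a (vsub y mu)))%:E) => [r _|_|]//; last first.
  by rewrite gt0_mulye// lte_fin expR_gt0.
rewrite -EFinM => -[rE]; congr EFin.
apply: (mulIf (x := expR (- (dotp a a / 2)))); first by rewrite gt_eqF// expR_gt0.
by rewrite rE -expRD subrr expR0.
Qed.

(** Near t = 0 a nonzero linear term t x would exceed the growth of order t^2 k on the right. *)
Lemma expR_linear_bound_eq0 (x k : R) : (0 <= k)%R ->
  (forall t, 1 + t * x <= expR (t ^+ 2 * k))%R -> x = 0%R.
Proof.
move=> k0 H; apply/eqP/negPn/negP => x0.
have x20 : (0 < x ^+ 2)%R by rewrite exprn_even_gt0.
(* The test point is t = x / M. With M >= 1, the summand 2 x^2 k forces s = t^2 k <= 1/2, where exp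
   s <= 1 + 2 s; the hypothesis then gives M <= 2 k, against the summands 2 k and 1. *)
pose M : R := (2 * k + 2 * x ^+ 2 * k + 1)%R.
have xk0 : (0 <= x ^+ 2 * k)%R by rewrite mulr_ge0// ltW.
have M0 : (0 < M)%R by rewrite /M; nra.
pose s : R := (x ^+ 2 * k / M ^+ 2)%R.
have sM : (s * M ^+ 2 = x ^+ 2 * k)%R by rewrite /s divfK// gt_eqF// exprn_gt0.
have s0 : (0 <= s)%R by rewrite /s divr_ge0// exprn_ge0// ltW.
have s1 : (s <= 1 / 2)%R.
  rewrite /s ler_pdivrMr ?exprn_gt0//.
  have M1 : (1 <= M)%R by rewrite /M; nra.
  have M2 : (2 * (x ^+ 2 * k) <= M)%R by rewrite /M; nra.
  have : (M <= M ^+ 2)%R by rewrite expr2 ler_peMr// ltW.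
  by nra.
have es : (expR s <= 1 + 2 * s)%R.
  have h1 := expR_ge1Dx (- s)%R.
  have h2 : (expR s * expR (- s) = 1)%R by rewrite -expRD subrr expR0.
  have h3 := expR_gt0 s.
  nra.
have := le_trans (H (x / M)%R) _.
move=> /(_ _ (_ : _ <= 1 + 2 * s)%R).
have -> : ((x / M) ^+ 2 * k = s)%R by rewrite /s expr_div_n; ring.
move=> /(_ es).
rewrite lerD2l => h.
have : (x ^+ 2 * M <= 2 * (x ^+ 2 * k))%R.
  rewrite -sM.
  have -> : (x ^+ 2 * M = x / M * x * M ^+ 2)%R by field; rewrite gt_eqF.
  have := ler_wpM2r (exprn_ge0 2 (ltW M0)) h.
  by rewrite (_ : 2 * (s * M ^+ 2) = 2 * s * M ^+ 2)%R ?mulrA//; apply.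
rewrite mulrCA ler_pM2l// /M => {}h.
nra.
Qed.

(** Domination of |s| by exp s + exp (- s), whose integrals [gaussian_mgf] computes. *)
Lemma gaussian_integrable n (mu a : n.-tuple R) :
  (gaussian mu).-integrable setT (fun y => (dotp a (vsub y mu))%:E).
Proof.
have me b : measurable_fun setT (fun y => (expR (dotp b (vsub y mu)))%:E).
  apply/measurable_EFinP/measurableT_comp => //.
  exact: measurable_gaussian_exponent.
apply/integrableP; split.
  by apply/measurable_EFinP; exact: measurable_gaussian_exponent.
apply: (@le_lt_trans _ _ (\int[gaussian mu]_y
   ((expR (dotp a (vsub y mu)))%:E + (expR (dotp (vscale (-1) a) (vsub y mu)))%:E))).
  apply: ge0_le_integral => //=.
  - by apply/measurable_EFinP/measurableT_comp => //; exact: measurable_gaussian_exponent.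
  - by apply: emeasurable_funD; exact: me.
  - move=> y _; rewrite -EFinD lee_fin dotpZl mulN1r.
    set s := dotp _ _.
    have h1 := expR_ge1Dx s; have h2 := expR_ge1Dx (- s)%R.
    have h3 := expR_ge0 s; have h4 := expR_ge0 (- s)%R.
    by rewrite ler_norml; apply/andP; split; lra.
rewrite ge0_integralD//.
by rewrite !gaussian_mgf -EFinD ltry.
Qed.

(* [1 + s <= exp s] turns the moment generating function into the bound of
   [expR_linear_bound_eq0] on the mean. *)
Lemma gaussian_mean0 n (mu a : n.-tuple R) :
  \int[gaussian mu]_y (dotp a (vsub y mu))%:E = 0.
Proof.
have ia := gaussian_integrable mu a.
have fa := integrable_fin_num measurableT ia.
rewrite -(fineK fa); congr EFin.
apply: (@expR_linear_bound_eq0 _ (dotp a a / 2)).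
  by rewrite divr_ge0// dotpp_ge0.
move=> t.
have -> : (t ^+ 2 * (dotp a a / 2) = dotp (vscale t a) (vscale t a) / 2)%R.
  by rewrite dotpZl dotpC dotpZl; field.
rewrite -lee_fin -(gaussian_mgf mu) EFinD EFinM fineK//.
rewrite -integralZl//.
have -> : 1 = \int[gaussian mu]_y (cst 1 y).
  by rewrite integral_cst//= mul1e probability_setT.
have i1 : (gaussian mu).-integrable setT (cst 1) by exact: finite_measure_integrable_cst.
have ita : (gaussian mu).-integrable setT (fun y => t%:E * (dotp a (vsub y mu))%:E).
  exact: integrableZl.
rewrite -integralD//.
have me : measurable_fun setT (fun y => (expR (dotp (vscale t a) (vsub y mu)))%:E).
  apply/measurable_EFinP/measurableT_comp => //.
  exact: measurable_gaussian_exponent.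
apply: le_integral => //.
- exact: integrableD.
- apply/integrableP; split => //.
  under eq_integral do rewrite gee0_abs ?lee_fin ?expR_ge0//.
  by rewrite gaussian_mgf ltry.
- move=> y _; rewrite -EFinM -EFinD lee_fin dotpZl.
  exact: expR_ge1Dx.
Qed.

End GaussianTilt.

(** * Total variation *)

Section TotalVariation.
Context d (T : measurableType d) {R : realType}.
Implicit Types (P Q : probability T R) (eps : R).
Local Open Scope ereal_scope.

Lemma TV_sym P Q : TV P Q = TV Q P.
Proof.
rewrite /TV; congr ereal_sup; apply: eq_imagel => A mA.
have := fin_num_measure P A mA; have := fin_num_measure Q A mA.
by move=> /fineK <- /fineK <-; rewrite -!EFinB !abse_EFin distrC.
Qed.

Lemma TV_measure_le P Q eps A : TV P Q <= eps%:E -> measurable A ->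
  P A <= Q A + eps%:E.
Proof.
move=> tv mA.
have : `|P A - Q A| <= eps%:E.
  by apply: le_trans tv; apply: ereal_sup_ubound; exists A.
have := fin_num_measure P A mA; have := fin_num_measure Q A mA.
move=> /fineK <- /fineK <-; rewrite -EFinB abse_EFin -EFinD !lee_fin ler_norml.
by move=> /andP[_]; rewrite lerBlDl.
Qed.

Lemma TV_ge0 P Q : 0 <= TV P Q.
Proof.
apply: ereal_sup_ubound; exists setT => //.
by rewrite !probability_setT subee// abse0.
Qed.

(* Layer cake: [f] is the mean of the indicators of [u <= f] for a uniform [u]. *)
Let TV_integral_le1 P Q eps (f : T -> R) : TV P Q <= eps%:E ->
  measurable_fun setT f -> (forall x, (0 <= f x <= 1)%R) ->
  \int[P]_x (f x)%:E <= \int[Q]_x (f x)%:E + eps%:E.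
Proof.
move=> tv mf f01.
have e0 : 0 <= eps%:E := le_trans (TV_ge0 P Q) tv.
pose g (x : T * R) : \bar R := ((x.2 <= f x.1)%R%:R : R)%:E.
have mg : measurable_fun setT g.
  apply/measurable_EFinP.
  have mb : measurable_fun setT (fun b : bool => b%:R : R) by [].
  apply: (measurableT_comp mb); apply: measurable_fun_ler => //.
  exact: (measurableT_comp mf measurable_fst).
have g0 x : 0 <= g x by rewrite lee_fin ler0n.
have layer (L : probability T R) :
    \int[L]_x (f x)%:E = \int[uniform01]_u \int[L]_x g (x, u).
  rewrite -(fubini_tonelli (m1 := L) (m2 := @uniform01 R) g)//.
  by apply: eq_integral => x _; rewrite -(integral_uniform01_le (f01 x)).
have mG (L : probability T R) : measurable_fun setT (fun u => \int[L]_x g (x, u)).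
  exact: (measurable_fun_fubini_tonelli_G (m1 := L) g).
have G0 (L : probability T R) u : 0 <= \int[L]_x g (x, u).
  by apply: integral_ge0.
rewrite !layer.
apply: (@le_trans _ _ (\int[uniform01]_u (\int[Q]_x g (x, u) + cst eps%:E u))).
  apply: ge0_le_integral => //=.
  - by apply: emeasurable_funD.
  - move=> u _.
    have mS : measurable [set x | (u <= f x)%R].
      have := mf measurableT `[u, +oo[%classic (measurable_itv _).
      rewrite setTI; congr measurable; apply/seteqP; split => x /=;
        by rewrite in_itv/= andbT.
    have gE (L : probability T R) : \int[L]_x g (x, u) = L [set x | (u <= f x)%R].
      transitivity (\int[L]_x (\1_[set x | (u <= f x)%R] x)%:E).
        by apply: eq_integral => x _; rewrite /g indicE mem_setE.
      by rewrite integral_indic// setIT.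
    by rewrite !gE; exact: TV_measure_le.
rewrite ge0_integralD//.
have -> : \int[uniform01]_u cst eps%:E u = eps%:E.
  by rewrite integral_cst//= (@probability_setT _ _ _ (@uniform01 R)) mule1.
by [].
Qed.

Lemma TV_integral_le P Q eps (M : R) (f : T -> R) : TV P Q <= eps%:E ->
  (0 < M)%R -> measurable_fun setT f -> (forall x, (0 <= f x <= M)%R) ->
  \int[P]_x (f x)%:E <= \int[Q]_x (f x)%:E + (M * eps)%:E.
Proof.
move=> tv M0 mf fM.
have f01 x : (0 <= M^-1 * f x <= 1)%R.
  have /andP[fx0 fxM] := fM x.
  by rewrite mulr_ge0 ?invr_ge0 ?(ltW M0)//= mulrC ler_pdivrMr// mul1r.
have mfM : measurable_fun setT (fun x => M^-1 * f x)%R by exact: measurable_funM.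
have scale (L : probability T R) :
    \int[L]_x (f x)%:E = M%:E * \int[L]_x (M^-1 * f x)%:E.
  rewrite -ge0_integralZl//.
  - apply: eq_integral => x _; rewrite -EFinM mulrA divff ?mul1r//.
    by rewrite gt_eqF.
  - exact/measurable_EFinP.
  - by move=> x _; rewrite lee_fin; case/andP: (f01 x).
  - by rewrite lee_fin ltW.
rewrite !scale EFinM -ge0_muleDr.
- by rewrite lee_pmul2l ?lte_fin//; exact: TV_integral_le1.
- by apply: integral_ge0 => x _; rewrite lee_fin; case/andP: (f01 x).
- exact: le_trans (TV_ge0 P Q) tv.
Qed.

End TotalVariation.

(** * Moments of the estimator *)

Section PowerBounds.
Context {R : realType}.

(** Clipping changes nothing when |u| <= B, and otherwise moves u by at most |u| = B (|u| / B),
    where the quotient exceeds 1 and only grows under powers. The clipping bias is thus paid for by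
    a p-th moment. *)
Lemma clip_err (B u : R) p : 0 < B -> (0 < p)%N ->
  `|clip B u - u| <= B * (`|u| / B) ^+ p.
Proof.
move=> B0 p0; have rhs0 : 0 <= B * (`|u| / B) ^+ p.
  by rewrite mulr_ge0 ?exprn_ge0 ?divr_ge0// ltW.
have [uB|Bu] := leP `|u| B.
  move: uB; rewrite ler_norml => /andP[h1 h2].
  by rewrite /clip min_l// max_r// subrr normr0.
apply: (@le_trans _ _ `|u|).
  rewrite /clip; have [u0|u0] := leP 0 u.
    move: Bu; rewrite (ger0_norm u0) => Bu.
    rewrite min_r ?(ltW Bu)// max_r; last by lra.
    by rewrite ler_norml; apply/andP; split; lra.
  move: Bu; rewrite (ltr0_norm u0) => Bu.
  rewrite min_l; last by lra.
  rewrite max_l; last by lra.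
  by rewrite ler_norml; apply/andP; split; lra.
rewrite -[leLHS](mulrVK (x := B)) ?unitfE ?gt_eqF// mulrC ler_pM2l//.
by apply: ler_eXnr => //; rewrite ler_pdivlMr// mul1r ltW.
Qed.

(** A single term (l |u|)^p / p! of the exponential series, with p! <= p^p. The scale [l] is left
    free. *)
Lemma normX_le_expR (u l : R) p : 0 < l -> (0 < p)%N ->
  `|u| ^+ p <= (p%:R / l) ^+ p * (expR (l * u) + expR (- (l * u))).
Proof.
move=> l0; case: p => // p _.
have lu0 : 0 <= l * `|u| by rewrite mulr_ge0// ltW.
have h := expR_ge1Dxn p lu0.
have h2 : expR (l * `|u|) <= expR (l * u) + expR (- (l * u)).
  by case: ler0P => _; rewrite ?mulrN ?lerDr ?lerDl expR_ge0.
have f0 : 0 < (p.+1)`!%:R :> R by rewrite ltr0n fact_gt0.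
have h3 : (l * `|u|) ^+ p.+1 <= (p.+1)`!%:R * expR (l * `|u|).
  by rewrite -ler_pdivrMl// mulrC; lra.
have fle : (p.+1)`!%:R <= p.+1%:R ^+ p.+1 :> R.
  have fact_le N k : (k <= N)%N -> (k`! <= N ^ k)%N.
    by elim: k => // k IH kN; rewrite factS expnS leq_mul// IH// ltnW.
  by rewrite -natrX ler_nat fact_le.
rewrite expr_div_n mulrAC ler_pdivlMr ?exprn_gt0// mulrC -exprMn.
apply: (le_trans h3); apply: ler_pM => //; exact: expR_ge0.
Qed.

End PowerBounds.

Section GaussianMoments.
Context {R : realType} {n : nat}.
Implicit Types mu u v w a D : n.-tuple R.
Local Open Scope ereal_scope.

Lemma dotp_diff D mu x y :
  dotp D (vsub x y) = (dotp D (vsub x mu) - dotp D (vsub y mu))%R.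
Proof.
rewrite /dotp -sumrB; apply: eq_bigr => i _; rewrite !tnth_mktuple; ring.
Qed.

Lemma dotpDr u v w : (dotp u (vadd v w) = dotp u v + dotp u w)%R.
Proof. by rewrite dotpC dotpDl (dotpC v) (dotpC w). Qed.

Lemma dotpBr u v w : (dotp u (vsub v w) = dotp u v - dotp u w)%R.
Proof. by rewrite dotpC dotpBl (dotpC v) (dotpC w). Qed.

Lemma dotp_vaddle a v : (dotp (vadd a v) (vadd a v) <= 2 * dotp a a + 2 * dotp v v)%R.
Proof.
have := dotpp_ge0 (vsub a v).
by rewrite dotpBl !dotpBr dotpDl !dotpDr (dotpC v a); lra.
Qed.

Let ex mu a (y : n.-tuple R) : R := expR (dotp a (vsub y mu)).

Let mex mu a : measurable_fun setT (fun y => (ex mu a y)%:E).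
Proof.
apply/measurable_EFinP/measurableT_comp => //.
exact: measurable_gaussian_exponent.
Qed.

Let ex0 mu a y : 0 <= (ex mu a y)%:E. Proof. by rewrite lee_fin expR_ge0. Qed.

Let neg_dotp a : dotp (vscale (-1) a) (vscale (-1) a) = dotp a a.
Proof. by rewrite dotpZl dotpC dotpZl; ring. Qed.

(** The y-integral gives exp (|a|^2 / 2) + exp (|v + a|^2 / 2), the x-integral exp (|a|^2 / 2); the
    coefficient 3 / 2 comes from |v + a|^2 <= 2 |a|^2 + 2 |v|^2. *)
Let double_mgf mu v a :
  \int[gaussian mu]_y \int[gaussian mu]_x
    (((ex mu a y)%:E + (ex mu (vadd v a) y)%:E) * (ex mu (vscale (-1) a) x)%:E)
  <= (2 * expR (3 / 2 * dotp a a + dotp v v))%:E.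
Proof.
under eq_integral.
  move=> y _; rewrite ge0_integralZl//; last by rewrite adde_ge0.
  rewrite gaussian_mgf neg_dotp; over.
rewrite /= ge0_integralZr//; last 2 first.
- exact: emeasurable_funD.
- by move=> x _; rewrite adde_ge0.
rewrite ge0_integralD// !gaussian_mgf -EFinD -EFinM lee_fin.
have h1 : (expR (dotp a a / 2) * expR (dotp a a / 2) <= expR (3 / 2 * dotp a a + dotp v v))%R.
  rewrite -expRD ler_expR; have := dotpp_ge0 a; have := dotpp_ge0 v; lra.
have h2 : (expR (dotp (vadd v a) (vadd v a) / 2) * expR (dotp a a / 2) <=
    expR (3 / 2 * dotp a a + dotp v v))%R.
  by rewrite -expRD ler_expR; have := dotp_vaddle v a; lra.
by rewrite mulrDl; lra.
Qed.

(** [normX_le_expR] turns the power into exponentials of a = l D and of its opposite, each bounded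
    by [double_mgf]. The weight is the one that [hmc_rate_tilt_dist] produces; the factor 4 counts
    two signs and two summands of the weight. *)
Lemma gaussian_tilted_moment mu v D p : (0 < p)%N ->
  \int[gaussian mu]_y \int[gaussian mu]_x
    ((1 + expR (dotp v (vsub y mu))) * `|dotp D (vsub y x)| ^+ p)%:E
  <= ((Num.sqrt p%:R * enorm D) ^+ p * (4 * expR (3 / 2 * p%:R + dotp v v)))%:E.
Proof.
move=> p0.
(* The scale [l] below divides by |D|, so D = 0 is treated apart. *)
have [D0|D0] := eqVneq (dotp D D) 0%R.
  have Di i : tnth D i = 0%R.
    move/eqP: D0; rewrite psumr_eq0; last by move=> j _; rewrite -expr2 sqr_ge0.
    by move/allP => /(_ i (mem_index_enum _)) /=; rewrite mulf_eq0 orbb => /eqP.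
  have D0' z : dotp D z = 0%R.
    by rewrite /dotp big1// => i _; rewrite Di mul0r.
  under eq_integral do under eq_integral do rewrite D0' normr0 expr0n gtn_eqF// mulr0.
  rewrite integral0_eq//; last by move=> y _; rewrite integral0.
  by rewrite lee_fin mulr_ge0 ?exprn_ge0 ?mulr_ge0 ?sqrtr_ge0 ?expR_ge0.
have eD : (0 < enorm D)%R by rewrite sqrtr_gt0 lt_neqAle eq_sym D0 dotpp_ge0.
have sp : (0 < Num.sqrt p%:R :> R)%R by rewrite sqrtr_gt0 ltr0n.
(* At this scale the exponents l^2 |D|^2 equal p. *)
pose l : R := (Num.sqrt p%:R / enorm D)%R.
have l0 : (0 < l)%R by rewrite divr_gt0.
have lE : (p%:R / l = Num.sqrt p%:R * enorm D)%R.
  rewrite /l -[X in (X / _)%R](@sqr_sqrtr _ p%:R)//.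
  by field; rewrite !gt_eqF.
pose a := vscale l D.
have aa : dotp a a = p%:R.
  rewrite dotpZl dotpC dotpZl -sqr_enorm /l.
  rewrite -[RHS](@sqr_sqrtr _ p%:R)//.
  by field; rewrite !gt_eqF.
pose na := vscale (-1) a.
set K := (_ ^+ p)%R.
have K0 : (0 <= K)%R by rewrite exprn_ge0// mulr_ge0// ltW.
pose H a y x := ((ex mu a y)%:E + (ex mu (vadd v a) y)%:E) * (ex mu (vscale (-1) a) x)%:E.
have H0 a' y x : 0 <= H a' y x by rewrite mule_ge0// adde_ge0.
have mHx a' y : measurable_fun setT (H a' y) by exact: emeasurable_funM.
have mH2 a' : measurable_fun setT (fun z : n.-tuple R * n.-tuple R => H a' z.1 z.2).
  apply: emeasurable_funM.
    by apply: emeasurable_funD; exact: (measurableT_comp (mex _ _) measurable_fst).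
  exact: (measurableT_comp (mex _ _) measurable_snd).
have mHy a' : measurable_fun setT (fun y => \int[gaussian mu]_x H a' y x).
  exact: (measurable_fun_fubini_tonelli_F (m2 := gaussian mu)
    (fun z : n.-tuple R * n.-tuple R => H a' z.1 z.2)).
have iH0 a' y : 0 <= \int[gaussian mu]_x H a' y x by apply: integral_ge0.
pose f y x : \bar R := ((1 + expR (dotp v (vsub y mu))) * `|dotp D (vsub y x)| ^+ p)%:E.
have f0 y x : 0 <= f y x.
  by rewrite lee_fin mulr_ge0 ?exprn_ge0// addr_ge0// expR_ge0.
have mf2 : measurable_fun setT (fun z : n.-tuple R * n.-tuple R => f z.1 z.2).
  apply/measurable_EFinP/measurable_funM.
    apply: measurable_funD => //; apply: measurableT_comp => //.
    exact: (measurableT_comp (measurable_gaussian_exponent mu v) measurable_fst).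
  apply: measurable_funX; apply: measurableT_comp => //.
  by apply: measurable_dotp => //; exact: measurable_vsub.
have mfx y : measurable_fun setT (f y).
  exact: (measurableT_comp mf2 (pair1_measurable y)).
have fH y x : f y x <= K%:E * (H a y x + H na y x).
  have HE a' : H a' y x =
      ((ex mu a' y + ex mu (vadd v a') y) * ex mu (vscale (-1) a') x)%:E by [].
  rewrite /f !HE -EFinD -EFinM lee_fin.
  have := @normX_le_expR _ (dotp D (vsub y x)) l p l0 p0; rewrite lE -/K.
  have -> : (l * dotp D (vsub y x) = dotp a (vsub y mu) - dotp a (vsub x mu))%R.
    by rewrite (dotp_diff D mu) /a !dotpZl; ring.
  set s := dotp a _; set t := dotp a _ => h.
  have e0 := expR_ge0 (dotp v (vsub y mu)).
  have h1 : (0 <= 1 + expR (dotp v (vsub y mu)))%R by lra.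
  apply: (le_trans (ler_wpM2l h1 h)).
  have naE z : (dotp na z = - dotp a z)%R by rewrite (dotpZl (-1) a) mulN1r.
  have nnaE z : (dotp (vscale (-1) na) z = dotp a z)%R.
    by rewrite (dotpZl (-1) na) naE mulN1r opprK.
  rewrite /ex !dotpDl !nnaE !naE -/s -/t opprB !expRD.
  by rewrite le_eqVlt; apply/orP; left; apply/eqP; ring.
apply: (@le_trans _ _ (\int[gaussian mu]_y \int[gaussian mu]_x
   (K%:E * (H a y x + H na y x)))).
  apply: ge0_le_integral => //=.
  - by move=> y _; apply: integral_ge0 => x _; exact: f0.
  - exact: (measurable_fun_fubini_tonelli_F (m2 := gaussian mu)
      (fun z : n.-tuple R * n.-tuple R => f z.1 z.2)).
  - apply: (measurable_fun_fubini_tonelli_F (m2 := gaussian mu)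
      (fun z : n.-tuple R * n.-tuple R => K%:E * (H a z.1 z.2 + H na z.1 z.2))).
      by apply: emeasurable_funM => //; exact: emeasurable_funD.
    by move=> z; apply: mule_ge0; [rewrite lee_fin|exact: adde_ge0].
  - move=> y _; apply: ge0_le_integral => //=.
    + exact: mfx.
    + by apply: emeasurable_funM => //; exact: emeasurable_funD.
    + by move=> x _; exact: fH.
under eq_integral.
  move=> y _; rewrite ge0_integralZl//; last 2 first.
  - exact: emeasurable_funD.
  - by move=> x _; rewrite adde_ge0.
  rewrite ge0_integralD//; over.
rewrite ge0_integralZl//=; last 2 first.
- exact: emeasurable_funD.
- by move=> y _; rewrite adde_ge0.
rewrite ge0_integralD// EFinM; apply: lee_pmul => //.
  by rewrite adde_ge0//; apply: integral_ge0.
have h1 := double_mgf mu v a; have h2 := double_mgf mu v na.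
apply: (le_trans (leeD h1 h2)).
rewrite neg_dotp aa -EFinD lee_fin.
by rewrite le_eqVlt; apply/orP; left; apply/eqP; ring.
Qed.

End GaussianMoments.

(** * Hidden mean correction *)

Section ExpBounds.
Context {R : realType}.

(** The exponential is 1-Lipschitz on the nonpositive half-line, where the exponents of acceptance
    rates lie. *)
Lemma expR_le_dist (s t : R) : s <= 0 -> t <= 0 -> expR s <= expR t + `|s - t|.
Proof.
move=> s0 t0; have [st|ts] := leP s t.
  by rewrite ler_wpDr// ler_expR.
rewrite ger0_norm ?subr_ge0 ?(ltW ts)//.
have es1 : expR s <= 1 by rewrite -expR0 ler_expR.
have -> : expR t = expR s * expR (t - s) by rewrite -expRD; congr expR; ring.
have := expR_ge1Dx (t - s); have := expR_ge0 s; nra.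
Qed.

(** The tangent line at s gives a Lipschitz bound without sign condition, for use with the Gaussian
    exponent, which is unbounded. *)
Lemma expR_le_distM (s t : R) : expR s <= expR t + (expR s + expR t) * `|s - t|.
Proof.
have [st|ts] := leP s t.
  rewrite ler_wpDr ?ler_expR// mulr_ge0// addr_ge0//; exact: expR_ge0.
rewrite ger0_norm ?subr_ge0 ?(ltW ts)//.
have et : expR t = expR s * expR (t - s) by rewrite -expRD; congr expR; ring.
have h1 : expR s * (1 + (t - s)) <= expR t.
  by rewrite [leRHS]et ler_wpM2l// ?expR_ge0// expR_ge1Dx.
have h2 : 0 <= expR t * (s - t) by rewrite mulr_ge0 ?expR_ge0// subr_ge0 ltW.
by lra.
Qed.

Lemma expR1_le4 : expR 1 <= 4 :> R.
Proof.
have h1 : 1 / 2 <= expR (- (1 / 2)) :> R.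
  by have := expR_ge1Dx (- (1 / 2) : R); lra.
have h2 : expR (1 / 2) * expR (- (1 / 2)) = 1 :> R by rewrite -expRD subrr expR0.
have h3 : expR (1 / 2) <= 2 :> R by have := expR_ge0 (1 / 2 : R); nra.
have -> : expR 1 = expR (1 / 2) * expR (1 / 2) :> R.
  by rewrite -expRD; congr expR; field.
by have := expR_ge0 (1 / 2 : R); nra.
Qed.

(** Normalisation of two measures with masses [a1], [a2] and values [x1], [x2] on an event. For r =
    x1 / a1 <= 1, the quantity (r - t) a2 = (x1 - x2) - r (a1 - a2) is at most 2 e in absolute
    value, and a2 >= 1/4 turns this into 8 e. *)
Lemma ratio_dist (x1 x2 a1 a2 t e : R) : 0 <= x1 <= a1 -> 0 < a1 -> 1 / 4 <= a2 ->
  x2 = t * a2 -> `|x1 - x2| <= e -> `|a1 - a2| <= e -> `|x1 / a1 - t| <= 8 * e.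
Proof.
move=> /andP[x10 x1a] a10 a24 x2E h1 h2.
set r := x1 / a1.
have x1E : x1 = r * a1 by rewrite /r divfK// gt_eqF.
have r0 : 0 <= r by rewrite divr_ge0// ltW.
have r1 : r <= 1 by rewrite ler_pdivrMr// mul1r.
have : `|(r - t) * a2| <= 2 * e.
  have -> : (r - t) * a2 = (x1 - x2) - r * (a1 - a2) by rewrite x2E x1E; ring.
  apply: le_trans (ler_normB _ _) _.
  have : `|r * (a1 - a2)| <= `|a1 - a2|.
    by rewrite normrM ger0_norm// ler_piMl.
  by lra.
rewrite normrM (ger0_norm (x := a2)); last by lra.
have := normr_ge0 (r - t); nra.
Qed.

(** Since s / B <= 1/256 <= exp (- 4), the p-th power of s / B is at most exp (- 4 p). This absorbs
    exp (3 p / 2) and leaves exp (- 5 p / 2 + w), which is below (delta / 2) exp (- 16) for p >= 64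
    ln (2 / delta). *)
Lemma exp_tail_le (B s delta w : R) p : 0 < B <= 1 -> 0 < delta ->
  0 <= s <= B / 256 -> w <= 2 -> 1 <= ln (2 / delta) ->
  64 * ln (2 / delta) <= p%:R ->
  8 * (B * B^-1 ^+ p * (s ^+ p * (4 * expR (3 / 2 * p%:R + w)))) <= delta.
Proof.
move=> /andP[B0 B1] dl0 /andP[s0 sB] w2 L1 pL.
have eL : expR (ln (2 / delta)) = 2 / delta by rewrite lnK// posrE divr_gt0.
have e4 : expR 4 <= 256 :> R.
  have -> : expR 4 = expR 1 ^+ 4 :> R by rewrite -expRM_natr mul1r.
  rewrite (_ : 256 = 4 ^+ 4); last by rewrite -natrX.
  by rewrite lerXn2r ?nnegrE ?expR_ge0// expR1_le4.
have e4V : 1 / 256 <= expR (- 4) :> R.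
  by rewrite expRN mul1r lef_pV2 ?posrE ?expR_gt0.
have scale_le : B^-1 ^+ p * s ^+ p <= expR (- 4 * p%:R).
  rewrite -exprMn expRM_natr lerXn2r ?nnegrE ?expR_ge0 ?mulr_ge0 ?invr_ge0 ?(ltW B0)//.
  apply: le_trans e4V.
  by rewrite mulrC ler_pdivrMr//; lra.
(* The bound exp 16 >= 17 comes from 1 + x <= exp x, and 32 / 34 < 1 absorbs the constants 8 and
   4. *)
have exp_le : expR (- 4 * p%:R) * expR (3 / 2 * p%:R + w) <=
    (delta / 2) * (1 / 17).
  rewrite -expRD.
  apply: (@le_trans _ _ (expR (- ln (2 / delta)) * expR (- 16))).
    by rewrite -expRD ler_expR; lra.
  rewrite !expRN eL invf_div ler_wpM2l//; first by rewrite divr_ge0// ltW.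
  rewrite mul1r lef_pV2 ?posrE ?expR_gt0//.
  by have := expR_ge1Dx (16 : R); lra.
have e0 := expR_ge0 (3 / 2 * p%:R + w).
have sc0 : 0 <= B^-1 ^+ p * s ^+ p.
  by rewrite mulr_ge0 ?exprn_ge0// invr_ge0 ltW.
have h := le_trans (ler_wpM2r e0 scale_le) exp_le.
have h0 := mulr_ge0 sc0 e0.
have -> : 8 * (B * B^-1 ^+ p * (s ^+ p * (4 * expR (3 / 2 * p%:R + w)))) =
  B * (32 * (B^-1 ^+ p * s ^+ p * expR (3 / 2 * p%:R + w))) by ring.
move: h h0; move: (_ * _ * expR _) => X h h0.
apply: (@le_trans _ _ (32 * X)); last by lra.
by rewrite ler_piMl//; lra.
Qed.

End ExpBounds.

Lemma integral_probability_cst d (T : measurableType d) (R : realType)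
    (P : probability T R) (k : R) : (\int[P]_x k%:E = k%:E)%E.
Proof. by rewrite integral_cst//= probability_setT mule1. Qed.

Lemma ge0_integral_le_dist d (T : measurableType d) (R : realType)
    (P : {measure set T -> \bar R}) (A : set T) (f g : T -> R) : measurable A ->
  measurable_fun setT f -> measurable_fun setT g ->
  (forall x, 0 <= f x) -> (forall x, 0 <= g x) ->
  (\int[P]_(x in A) (f x)%:E <=
   \int[P]_(x in A) (g x)%:E + \int[P]_x `|f x - g x|%:E)%E.
Proof.
move=> mA mf mg f0 g0.
have mfA : measurable_fun A (fun x => (f x)%:E).
  by apply: measurable_funTS; exact/measurable_EFinP.
have mgA : measurable_fun A (fun x => (g x)%:E).
  by apply: measurable_funTS; exact/measurable_EFinP.
have mfg : measurable_fun setT (fun x => `|f x - g x|%:E).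
  by apply/measurable_EFinP/measurableT_comp => //; exact: measurable_funB.
have mfgA : measurable_fun A (fun x => `|f x - g x|%:E) by exact: measurable_funTS.
apply: (@le_trans _ _ (\int[P]_(x in A) ((g x)%:E + `|f x - g x|%:E))%E).
  apply: ge0_le_integral => //.
  - by move=> x _; rewrite lee_fin.
  - exact: emeasurable_funD.
  - move=> x _; rewrite -EFinD lee_fin.
    by have := ler_norm (f x - g x); lra.
rewrite ge0_integralD//; last by move=> x _; rewrite lee_fin.
by apply: leeD2l; exact: ge0_subset_integral.
Qed.

Section HiddenMean.
Context {R : realType} {m : nat}.
Implicit Types (mu v x y : m.-tuple R) (Q G D : probability (m.-tuple R) R).

Lemma measurable_clip (B : R) : measurable_fun setT (clip B).
Proof.
by apply: measurable_maxr => //; apply: measurable_minr.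
Qed.

Lemma clip_norm_le (B u : R) : 0 <= B -> `|clip B u| <= B.
Proof.
move=> B0; rewrite ler_norml /clip le_max lexx /= ge_max.
by rewrite ge_min lexx orbT andbT; lra.
Qed.

Lemma measurable_hmc_dotp : measurable_fun setT
  (fun x : m.-tuple R * (m.-tuple R * m.-tuple R) => dotp x.2.2 (vsub x.1 x.2.1)).
Proof.
apply: measurable_dotp; first exact: measurableT_comp measurable_snd measurable_snd.
apply: measurable_vsub => //.
exact: measurableT_comp measurable_fst measurable_snd.
Qed.

Lemma measurable_hmc_est (B : R) : measurable_fun setT
  (fun x : m.-tuple R * (m.-tuple R * m.-tuple R) => hmc_est B x.1 x.2).
Proof. exact: measurableT_comp (measurable_clip B) measurable_hmc_dotp. Qed.

(** The integrand is the density of [gaussian_tilt] times the constant exp (|v|^2 / 2 - r); the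
    offset [r] will be [B]. *)
Lemma gaussian_tilt_set mu v (r : R) A : measurable A ->
  (\int[gaussian mu]_(y in A) (expR (dotp v (vsub y mu) - r))%:E =
   gaussian (vadd mu v) A * (expR (dotp v v / 2 - r))%:E)%E.
Proof.
move=> mA.
have mi : measurable_fun setT (fun y : m.-tuple R => (\1_A y : R)%:E).
  by apply/measurable_EFinP; exact: measurable_indic.
have i0 (y : m.-tuple R) : (0 <= (\1_A y : R)%:E)%E by rewrite lee_fin.
have mt : measurable_fun setT
    (fun y => (expR (dotp v (vsub y mu) - dotp v v / 2))%:E).
  by apply/measurable_EFinP; exact: measurable_tilt.
have t0 y : (0 <= (expR (dotp v (vsub y mu) - dotp v v / 2))%:E)%E.
  by rewrite lee_fin expR_ge0.
transitivity (\int[gaussian (vadd mu v)]_y (\1_A y)%:E *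
    (expR (dotp v v / 2 - r))%:E)%E; last by rewrite integral_indic// setIT.
rewrite gaussian_tilt// -ge0_integralZr//; last exact: emeasurable_funM.
rewrite [LHS]integral_mkcond; apply: eq_integral => y _.
rewrite -muleA -EFinM -expRD patchE indicE.
have -> : dotp v (vsub y mu) - dotp v v / 2 + (dotp v v / 2 - r) =
    dotp v (vsub y mu) - r by ring.
by case: ifP => _; rewrite ?mul1r ?mul0r.
Qed.

(** * Stability of the acceptance rate in total variation *)

Section Rates.
Variables (B : R) (D : probability (m.-tuple R) R).
Hypothesis B0 : 0 < B.

Let estB y (z : m.-tuple R * m.-tuple R) : `|hmc_est B y z| <= B.
Proof. by apply: clip_norm_le; exact: ltW. Qed.

Let mest := measurable_hmc_est B.

(** [Q] is here only the law of Y' inside the estimator, so that it can be replaced separately from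
    the law of the proposal. *)
Definition hmc_mean Q y : R := mean_factor (prod_prob Q D) B (hmc_est B) y.

Definition hmc_rate Q y : R := accept_rate (prod_prob Q D) B (hmc_est B) y.

Lemma hmc_meanE Q y :
  (\int[prod_prob Q D]_z (accept_factor B (hmc_est B) y z)%:E = (hmc_mean Q y)%:E)%E.
Proof. exact: mean_factorE. Qed.

Lemma hmc_mean_le1 Q y : hmc_mean Q y <= 1.
Proof. exact: mean_factor_le1. Qed.

Lemma measurable_hmc_rate Q : measurable_fun setT (hmc_rate Q).
Proof. exact: measurable_accept_rate. Qed.

Lemma hmc_rate_le1 Q y : hmc_rate Q y <= 1.
Proof. exact: accept_rate_le1. Qed.

Let mfactor y : measurable_fun setT (accept_factor B (hmc_est B) y).
Proof.
exact: measurableT_comp (measurable_accept_factor B mest) (pair1_measurable y).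
Qed.

(** For fixed [y] and Delta the factor is a function of Y' with values in [0, 1]; the resulting
    bound is averaged over Delta. *)
Lemma hmc_mean_TV Q G (eps : R) y : (TV Q G <= eps%:E)%E ->
  hmc_mean Q y <= hmc_mean G y + eps.
Proof.
move=> tv.
have e0 : (0 <= eps%:E)%E := le_trans (TV_ge0 Q G) tv.
have h0 z : (0 <= (accept_factor B (hmc_est B) y z)%:E)%E.
  by rewrite lee_fin accept_factor_ge0.
have mh : measurable_fun setT (fun z => (accept_factor B (hmc_est B) y z)%:E).
  exact/measurable_EFinP.
have tonelli (L : probability (m.-tuple R) R) : (\int[prod_prob L D]_z (accept_factor B (hmc_est B) y z)%:E =
    \int[D]_u \int[L]_x (accept_factor B (hmc_est B) y (x, u))%:E)%E.
  exact: (fubini_tonelli2 (m1 := L) (m2 := D)).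
have mL (L : probability (m.-tuple R) R) : measurable_fun setT
    (fun u => \int[L]_x (accept_factor B (hmc_est B) y (x, u))%:E)%E.
  exact: (measurable_fun_fubini_tonelli_G (m1 := L)
    (fun z => (accept_factor B (hmc_est B) y z)%:E)).
have L0 (L : probability (m.-tuple R) R) u : (0 <= \int[L]_x (accept_factor B (hmc_est B) y (x, u))%:E)%E.
  exact: integral_ge0.
rewrite -lee_fin EFinD -!hmc_meanE !tonelli.
apply: (@le_trans _ _ (\int[D]_u
    (\int[G]_x (accept_factor B (hmc_est B) y (x, u))%:E + cst eps%:E u)))%E.
  apply: ge0_le_integral => //=.
  - exact: emeasurable_funD.
  - move=> u _; rewrite -[eps]mul1r; apply: TV_integral_le => //.
      exact: measurableT_comp (mfactor y) (pair2_measurable u).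
    by move=> x; rewrite accept_factor_ge0//= accept_factor_le1.
rewrite ge0_integralD//.
by rewrite integral_cst//= probability_setT mule1.
Qed.

Lemma hmc_rate_TV Q G (eps : R) y : (TV Q G <= eps%:E)%E ->
  hmc_rate Q y <= hmc_rate G y + 2 * B * eps.
Proof.
move=> tv; have h1 := hmc_mean_TV y tv.
have h2 : hmc_mean G y <= hmc_mean Q y + eps by apply: hmc_mean_TV; rewrite TV_sym.
have arg0 L : 2 * B * (hmc_mean L y - 1) <= 0.
  by rewrite pmulr_rle0 ?mulr_gt0// subr_le0 hmc_mean_le1.
apply: (le_trans (expR_le_dist (arg0 Q) (arg0 G))).
rewrite lerD2l -mulrBr normrM gtr0_norm ?mulr_gt0// ler_pM2l ?mulr_gt0//.
by rewrite ler_norml; apply/andP; split; lra.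
Qed.

(** Two replacements: the law of the proposal costs eps, the rate being at most 1; the law inside
    the estimator costs 2 B eps, uniformly in y. *)
Lemma integral_hmc_rate_TV Q G (eps : R) (A : set (m.-tuple R)) :
  (TV Q G <= eps%:E)%E -> measurable A ->
  (\int[Q]_(y in A) (hmc_rate Q y)%:E <=
   \int[G]_(y in A) (hmc_rate G y)%:E + ((1 + 2 * B) * eps)%:E)%E.
Proof.
move=> tv mA.
have e0 : (0 <= eps%:E)%E := le_trans (TV_ge0 Q G) tv.
have patchA (f : m.-tuple R -> R) (L : probability (m.-tuple R) R) :
    (\int[L]_(y in A) (f y)%:E = \int[L]_y (\1_A y * f y)%:E)%E.
  rewrite integral_mkcond; apply: eq_integral => y _.
  by rewrite patchE indicE; case: ifP; rewrite ?mul1r ?mul0r.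
have mAr L : measurable_fun setT (fun y => \1_A y * hmc_rate L y).
  by apply: measurable_funM; [exact: measurable_indic|exact: measurable_hmc_rate].
have Ar01 L y : 0 <= \1_A y * hmc_rate L y <= 1.
  rewrite mulr_ge0 ?expR_ge0//= indicE; case: (_ \in _); rewrite ?mul1r ?mul0r//.
  exact: hmc_rate_le1.
have indic_le (i : bool) (r s t : R) : 0 <= t -> r <= s + t ->
    i%:R * r <= i%:R * s + t.
  by case: i; rewrite ?mul1r ?mul0r ?add0r.
rewrite !patchA.
have := TV_integral_le tv ltr01 (mAr Q) (Ar01 Q); rewrite mul1r => h.
apply: (le_trans h).
have -> : ((1 + 2 * B) * eps)%:E = ((2 * B * eps)%:E + eps%:E)%E.
  by rewrite -EFinD; congr EFin; ring.
suff h2 : (\int[G]_y (\1_A y * hmc_rate Q y)%:E <=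
    \int[G]_y (\1_A y * hmc_rate G y)%:E + (2 * B * eps)%:E)%E.
  apply: (le_trans (leeD2r eps%:E h2)).
  by rewrite (addeA _ (2 * B * eps)%:E eps%:E).
apply: (@le_trans _ _ (\int[G]_y ((\1_A y * hmc_rate G y)%:E + cst (2 * B * eps)%:E y))%E).
  apply: ge0_le_integral => //=.
  - by move=> y _; rewrite lee_fin; case/andP: (Ar01 Q y).
  - exact/measurable_EFinP.
  - by apply: emeasurable_funD => //; exact/measurable_EFinP.
  - move=> y _; rewrite -EFinD lee_fin indicE.
    apply: indic_le; last exact: hmc_rate_TV.
    by rewrite !mulr_ge0// ltW.
rewrite ge0_integralD//.
- by rewrite integral_cst//= probability_setT mule1.
- by move=> y _; rewrite lee_fin; case/andP: (Ar01 G y).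
- exact/measurable_EFinP.
- by move=> y _; rewrite lee_fin mulr_ge0// mulr_ge0// ltW.
Qed.

(** * Comparison of the acceptance rate with the Gaussian tilt *)

Section Tilt.
Variables (mu : m.-tuple R) (p : nat) (b : R).
Hypothesis p2 : (2 <= p)%N.
Hypothesis Dp : (\int[D]_u (enorm u ^+ p)%:E <= (b ^+ p)%:E)%E.
Hypothesis b01 : 0 <= b <= 1.

Let v := mean D.

Let G := gaussian mu.

Let KG := prod_prob G D.

Lemma measurable_enorm : measurable_fun setT (@enorm R m).
Proof.
have ms : measurable_fun setT (@Num.sqrt R).
  by apply: continuous_measurable_fun; exact: sqrt_continuous.
have mi : measurable_fun setT (@id (m.-tuple R)) by exact: measurable_id.
exact: measurableT_comp ms (measurable_dotp mi mi).
Qed.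

Let mDp : measurable_fun setT (fun u : m.-tuple R => (enorm u ^+ p)%:E).
Proof. by apply/measurable_EFinP/measurable_funX; exact: measurable_enorm. Qed.

Let Dp0 (u : m.-tuple R) : (0 <= (enorm u ^+ p)%:E)%E.
Proof. by rewrite lee_fin exprn_ge0// enorm_ge0. Qed.

Let sqr_le (t : R) : 0 <= t -> t ^+ 2 <= 1 + t ^+ p.
Proof.
move=> t0; have [t1|t1] := leP t 1.
  by rewrite ler_wpDr ?exprn_ge0// exprn_ile1.
by rewrite ler_wpDl// ler_weXn2l// ltW.
Qed.

Let integral_1Dp : (\int[D]_u (1 + (enorm u ^+ p)%:E) <= 2%:E)%E.
Proof.
rewrite ge0_integralD// integral_cst//= probability_setT mule1.
rewrite (_ : 2%:E = (1 + 1)%E)// leeD2l// (le_trans Dp)// lee_fin.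
by case/andP: b01 => b0 b1; rewrite exprn_ile1.
Qed.

Let integrable_1Dp : D.-integrable setT (fun u => (1 + (enorm u ^+ p)%:E)%E).
Proof.
apply/integrableP; split; first exact: emeasurable_funD.
apply: (@le_lt_trans _ _ (\int[D]_u (1 + (enorm u ^+ p)%:E))%E).
  by under eq_integral do rewrite gee0_abs ?adde_ge0//.
exact: le_lt_trans integral_1Dp (ltry _).
Qed.

Lemma integrable_coord i : D.-integrable setT (fun u : m.-tuple R => (tnth u i)%:E).
Proof.
have i2 : D.-integrable setT (fun u => (2%:E * (1 + (enorm u ^+ p)%:E))%E).
  exact: integrableZl.
apply: (le_integrable _ _ _ i2) => //.
  by apply/measurable_EFinP; exact: measurable_tnth.
move=> u _.
change (`|tnth u i|%:E <= `|2 * (1 + enorm u ^+ p)|%:E)%E; rewrite lee_fin.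
have h1 := sqr_le (enorm_ge0 u); rewrite sqr_enorm in h1.
have h2 : tnth u i ^+ 2 <= dotp u u.
  rewrite /dotp (bigD1 i)//= -expr2 lerDl; apply: sumr_ge0 => j _.
  by rewrite -expr2 sqr_ge0.
have h3 : 0 <= enorm u ^+ p by rewrite exprn_ge0// enorm_ge0.
rewrite [leRHS]ger0_norm; last by lra.
by rewrite ler_norml; apply/andP; split; nra.
Qed.

(** [mean] takes [fine] of each coordinate's expectation; integrability makes these genuine
    expectations, and linearity does the rest. *)
Lemma integral_dotp_mean x : D.-integrable setT (fun u => (dotp u x)%:E) /\
  (\int[D]_u (dotp u x)%:E = (dotp v x)%:E)%E.
Proof.
have ic i : D.-integrable setT (fun u : m.-tuple R => (tnth u i * tnth x i)%:E).
  by under eq_fun do rewrite EFinM; apply: integrableZr => //; exact: integrable_coord.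
have sumE (u : m.-tuple R) : (dotp u x)%:E = (\sum_(i < m) (tnth u i * tnth x i)%:E)%E.
  by rewrite sumEFin.
split.
  under eq_fun do rewrite sumE.
  by apply: (integrable_sum measurableT).
under eq_integral do rewrite sumE.
rewrite integral_sum//.
rewrite /dotp -sumEFin; apply: eq_bigr => i _.
under eq_integral do rewrite EFinM.
rewrite integralZr//; last exact: integrable_coord.
rewrite /v /mean tnth_mktuple unlock EFinM fineK//.
exact: integrable_fin_num (integrable_coord i).
Qed.

(* Integrate [2 <u, v> <= |u|^2 + |v|^2] over [u], where [v] is the mean. *)
Lemma dotp_mean_le2 : dotp v v <= 2.
Proof.
have [i1 e1] := integral_dotp_mean v.
have ik (k : R) : D.-integrable setT (fun=> k%:E) :=
  finite_measure_integrable_cst D k measurableT.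
have : (\int[D]_u ((2 * dotp u v)%:E) <= \int[D]_u ((dotp v v)%:E + (1 + (enorm u ^+ p)%:E)))%E.
  apply: le_integral => //.
  - by under eq_fun do rewrite EFinM; exact: integrableZl.
  - exact: integrableD.
  - move=> u _; rewrite -!EFinD lee_fin.
    have h1 := sqr_le (enorm_ge0 u); rewrite sqr_enorm in h1.
    have := dotpp_ge0 (vsub u v); rewrite dotpBl !dotpBr (dotpC v u); lra.
under eq_integral do rewrite EFinM.
rewrite integralZl// e1 integralD//.
rewrite integral_probability_cst => h.
have := le_trans h (leeD2l _ integral_1Dp).
by rewrite -EFinM -EFinD lee_fin; lra.
Qed.

Let U y (z : m.-tuple R * m.-tuple R) : R := dotp z.2 (vsub y z.1).

Let mU2 : measurable_fun setT (fun x : m.-tuple R * (m.-tuple R * m.-tuple R) => U x.1 x.2).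
Proof. exact: measurable_hmc_dotp. Qed.

Let mU y : measurable_fun setT (U y).
Proof. exact: measurableT_comp mU2 (pair1_measurable y). Qed.

Let mUp y : measurable_fun setT (fun z => (`|U y z| ^+ p)%:E).
Proof. by apply/measurable_EFinP/measurable_funX; exact: measurableT_comp. Qed.

Let gexp y : R := dotp v (vsub y mu).

Let p_gt0 : (0 < p)%N. Proof. exact: leq_trans p2. Qed.

(** For fixed Delta, centring Y' at mu leaves <Delta, y - mu>, as the Gaussian fluctuation has mean
    zero; averaging over Delta brings in [v]. The finite p-th moment supplies the integrability for
    the exchange. *)
Lemma integral_unclipped y : (\int[KG]_z (`|U y z| ^+ p)%:E < +oo)%E ->
  KG.-integrable setT (fun z => (U y z)%:E) /\
  (\int[KG]_z (U y z)%:E = (gexp y)%:E)%E.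
Proof.
move=> fin_p.
have ip : KG.-integrable setT (fun z => (1 + (`|U y z| ^+ p)%:E)%E).
  apply: integrableD => //; first exact: finite_measure_integrable_cst.
  apply/integrableP; split => //.
  by under eq_integral do rewrite gee0_abs ?lee_fin ?exprn_ge0//.
have iU : KG.-integrable setT (fun z => (U y z)%:E).
  apply: (le_integrable _ _ _ ip) => //; first exact/measurable_EFinP.
  move=> z _; rewrite -EFinD lee_fin.
  have u0 := normr_ge0 (U y z).
  have h : `|U y z| <= 1 + `|U y z| ^+ p.
    have [u1|u1] := leP `|U y z| 1; first by rewrite ler_wpDr// exprn_ge0.
    by rewrite ler_wpDl// ler_eXnr// ltW.
  by rewrite [leRHS]ger0_norm// addr_ge0// exprn_ge0.
split => //.
apply: (etrans (esym (integral21_prod_meas1 iU))).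
transitivity (\int[D]_u (dotp u (vsub y mu))%:E)%E; last first.
  by have [_ ->] := integral_dotp_mean (vsub y mu).
apply: eq_integral => u _; rewrite /fubini_G /U /=.
under eq_integral do rewrite (dotp_diff _ mu) EFinB.
rewrite integralB_EFin//; last 2 first.
- exact: finite_measure_integrable_cst.
- exact: gaussian_integrable.
by rewrite gaussian_mean0 sube0 integral_probability_cst.
Qed.

(* B^(1 - p) *)
Let scl : R := B * B^-1 ^+ p.

Let scl0 : 0 <= scl.
Proof. by rewrite mulr_ge0 ?exprn_ge0 ?invr_ge0// ltW. Qed.

(** The rate is exp (w - B) with w the mean of the clipped estimator, and [clip_err] bounds |w -
    gexp y|. In [expR_le_distM] the two exponentials are at most 1 and exp (gexp y), whence the
    weight. *)
Lemma hmc_rate_tilt_dist y :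
  (`|hmc_rate G y - expR (gexp y - B)|%:E <=
   (1 + expR (gexp y))%:E * (scl%:E * \int[KG]_z (`|U y z| ^+ p)%:E))%E.
Proof.
(* Where the p-th moment is infinite the bound is void, so the unclipped
   estimator may be assumed integrable. *)
have [->|fin_p] := eqVneq (\int[KG]_z (`|U y z| ^+ p)%:E)%E +oo%E.
  rewrite gt0_muley; last first.
    by rewrite lte_fin mulr_gt0// exprn_gt0// invr_gt0.
  by rewrite gt0_muley ?leey// lte_fin ltr_pwDl// expR_ge0.
have [iU eU] : KG.-integrable setT (fun z => (U y z)%:E) /\
    (\int[KG]_z (U y z)%:E = (gexp y)%:E)%E.
  by apply: integral_unclipped; rewrite ltey.
pose q := hmc_mean G y; pose w := 2 * B * q - B.
have ih : KG.-integrable setT (fun z => (accept_factor B (hmc_est B) y z)%:E).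
  apply/integrableP; split; first exact/measurable_EFinP.
  under eq_integral do rewrite gee0_abs ?lee_fin ?accept_factor_ge0//.
  by rewrite hmc_meanE ltry.
have iw : KG.-integrable setT (fun z => ((2 * B)%:E * (accept_factor B (hmc_est B) y z)%:E - B%:E)%E).
  apply: integrableB => //; first exact: integrableZl.
  exact: finite_measure_integrable_cst.
(* The acceptance factor is affine in the clipped estimator; inverting the relation transfers
   integrability and the value of the integral. *)
have clipE z : ((2 * B)%:E * (accept_factor B (hmc_est B) y z)%:E - B%:E =
    (clip B (U y z))%:E)%E.
  rewrite -EFinM -EFinB; congr EFin; rewrite /accept_factor /hmc_est /U.
  by field; rewrite gt_eqF.
have ew : (\int[KG]_z (clip B (U y z))%:E = w%:E)%E.
  under eq_integral do rewrite -clipE.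
  rewrite integralB//; last 2 first.
  - exact: integrableZl.
  - exact: finite_measure_integrable_cst.
  transitivity ((2 * B)%:E * (hmc_mean G y)%:E - B%:E)%E; last by [].
  congr (_ - _)%E; first by rewrite integralZl// hmc_meanE.
  exact: integral_probability_cst.
have ic : KG.-integrable setT (fun z => (clip B (U y z))%:E).
  by move: iw; under eq_fun do rewrite clipE.
have wg : (`|w - gexp y|%:E <= scl%:E * \int[KG]_z (`|U y z| ^+ p)%:E)%E.
  rewrite -ge0_integralZl//.
  rewrite -abse_EFin EFinB -ew -eU -integralB_EFin//.
  apply: (le_trans (le_abse_integral _ _ _)) => //.
    by apply/measurable_EFinP/measurable_funB => //; exact: measurableT_comp (measurable_clip B) (mU y).
  apply: ge0_le_integral => //.
  - apply/measurable_EFinP; apply: measurableT_comp => //; apply: measurable_funB => //.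
    exact: measurableT_comp (measurable_clip B) (mU y).
  - exact: emeasurable_funM.
  - move=> z _; rewrite -EFinB abse_EFin -EFinM lee_fin.
    apply: (le_trans (clip_err (U y z) B0 p_gt0)).
    by rewrite exprMn /scl -mulrA [X in _ * X]mulrC.
have rateE : hmc_rate G y = expR (w - B).
  by rewrite /hmc_rate /accept_rate -/(hmc_mean G y) -/q /w; congr expR; ring.
apply: (@le_trans _ _ ((1 + expR (gexp y))%:E * `|w - gexp y|%:E)%E); last first.
  by rewrite lee_wpmul2l// lee_fin addr_ge0// expR_ge0.
rewrite -EFinM lee_fin rateE.
have gB : expR (gexp y - B) <= expR (gexp y) by rewrite ler_expR gerBl ltW.
have wB : expR (w - B) <= 1 by rewrite -rateE hmc_rate_le1.
have h1 := expR_le_distM (w - B) (gexp y - B).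
have h2 := expR_le_distM (gexp y - B) (w - B).
have dE : (w - B) - (gexp y - B) = w - gexp y by ring.
rewrite dE in h1; rewrite distrC dE in h2.
have h3 : (expR (w - B) + expR (gexp y - B)) * `|w - gexp y| <=
    (1 + expR (gexp y)) * `|w - gexp y|.
  by rewrite ler_wpM2r// lerD.
move: h1 h2 h3; move: (expR (w - B)) (expR (gexp y - B))
  ((1 + expR (gexp y)) * `|w - gexp y|) (`|w - gexp y|) => r s X t h1 h2 h3.
by rewrite ler_norml; apply/andP; split; lra.
Qed.

(** The bound of [gaussian_tilted_moment] averaged over Delta, with b^p for the p-th moment of
    |Delta|, times the clipping factor B^(1 - p). *)
Definition tilt_error : R :=
  scl * ((Num.sqrt p%:R * b) ^+ p * (4 * expR (3 / 2 * p%:R + dotp v v))).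

(** The Gaussian moment bound holds for each fixed value of Delta, so Tonelli places the integral
    over Delta outermost. *)
Lemma integral_hmc_rate_tilt_dist :
  (\int[G]_y `|hmc_rate G y - expR (gexp y - B)|%:E <= tilt_error%:E)%E.
Proof.
have mg : measurable_fun setT gexp by exact: measurable_gaussian_exponent.
have mI : measurable_fun setT (fun y => \int[KG]_z (`|U y z| ^+ p)%:E)%E.
  apply: (measurable_fun_fubini_tonelli_F (m2 := prod_prob G D)
    (fun x : m.-tuple R * (m.-tuple R * m.-tuple R) => (`|U x.1 x.2| ^+ p)%:E)).
    by apply/measurable_EFinP/measurable_funX; exact: measurableT_comp.
  by move=> x; rewrite lee_fin exprn_ge0.
have I0 y : (0 <= \int[KG]_z (`|U y z| ^+ p)%:E)%E.
  by apply: integral_ge0 => z _; rewrite lee_fin exprn_ge0.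
have g10 y : (0 <= (1 + expR (gexp y))%:E)%E by rewrite lee_fin addr_ge0// expR_ge0.
have mg1 : measurable_fun setT (fun y => (1 + expR (gexp y))%:E).
  by apply/measurable_EFinP/measurable_funD => //; exact: measurableT_comp.
apply: (@le_trans _ _ (\int[G]_y
    ((1 + expR (gexp y))%:E * (scl%:E * \int[KG]_z (`|U y z| ^+ p)%:E)))%E).
  apply: ge0_le_integral => //.
  - apply/measurable_EFinP/measurableT_comp => //; apply: measurable_funB.
      exact: measurable_hmc_rate.
    by apply: measurableT_comp => //; exact: measurable_funB.
  - by apply: emeasurable_funM => //; exact: emeasurable_funM.
  - by move=> y _; exact: hmc_rate_tilt_dist.
pose f y u : \bar R := (\int[G]_x ((1 + expR (gexp y)) * `|dotp u (vsub y x)| ^+ p)%:E)%E.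
have f0 y u : (0 <= f y u)%E.
  by apply: integral_ge0 => x _; rewrite lee_fin mulr_ge0 ?exprn_ge0// addr_ge0// expR_ge0.
have mf : measurable_fun setT (fun x : m.-tuple R * m.-tuple R => f x.1 x.2).
  apply: (measurable_fun_fubini_tonelli_F (m2 := G) (fun x : (m.-tuple R * m.-tuple R) * m.-tuple R =>
    ((1 + expR (gexp x.1.1)) * `|dotp x.1.2 (vsub x.1.1 x.2)| ^+ p)%:E)).
    apply/measurable_EFinP/measurable_funM.
      apply: measurable_funD => //; apply: measurableT_comp => //.
      exact: (measurableT_comp mg (measurableT_comp measurable_fst measurable_fst)).
    apply: measurable_funX; apply: measurableT_comp => //; apply: measurable_dotp.
      exact: (measurableT_comp measurable_snd measurable_fst).
    apply: measurable_vsub => //.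
    exact: (measurableT_comp measurable_fst measurable_fst).
  by move=> x; rewrite lee_fin mulr_ge0 ?exprn_ge0// addr_ge0// expR_ge0.
rewrite (_ : (\int[G]_y _)%E = (scl%:E * \int[G]_y \int[D]_u f y u)%E); last first.
  rewrite -ge0_integralZl//; last 2 first.
  - exact: (measurable_fun_fubini_tonelli_F (m2 := D) (fun x : m.-tuple R * m.-tuple R => f x.1 x.2)).
  - by move=> y _; exact: integral_ge0.
  apply: eq_integral => y _; rewrite muleCA; congr (_ * _)%E.
  rewrite -ge0_integralZl//.
  rewrite -(fubini_tonelli2 (m1 := G) (m2 := D)
    (fun z => ((1 + expR (gexp y))%:E * (`|U y z| ^+ p)%:E)%E))//.
  exact: emeasurable_funM.
rewrite /tilt_error (EFinM scl); apply: lee_wpmul2l => //.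
rewrite (fubini_tonelli (m1 := G) (m2 := D) (fun x : m.-tuple R * m.-tuple R => f x.1 x.2))//.
set c := 4 * _; have c0 : 0 <= c by rewrite mulr_ge0// expR_ge0.
have s0 : 0 <= Num.sqrt p%:R ^+ p :> R by rewrite exprn_ge0// sqrtr_ge0.
apply: (@le_trans _ _ (\int[D]_u ((Num.sqrt p%:R ^+ p * c)%:E * (enorm u ^+ p)%:E))%E).
  apply: ge0_le_integral => //.
  - by move=> u _; exact: integral_ge0.
  - exact: (measurable_fun_fubini_tonelli_G (m1 := G) (fun x : m.-tuple R * m.-tuple R => f x.1 x.2)).
  - exact: emeasurable_funM.
  - move=> u _; apply: (le_trans (gaussian_tilted_moment mu v u p_gt0)).
    by rewrite -EFinM lee_fin exprMn mulrAC.
rewrite ge0_integralZl//; last by rewrite lee_fin mulr_ge0.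
apply: (@le_trans _ _ ((Num.sqrt p%:R ^+ p * c)%:E * (b ^+ p)%:E)%E).
  by rewrite lee_wpmul2l// lee_fin mulr_ge0.
by rewrite -EFinM lee_fin exprMn mulrAC.
Qed.

Let mgexp : measurable_fun setT gexp.
Proof. exact: measurable_gaussian_exponent. Qed.

(** Adds the cost of replacing [Q] to that of replacing the rate by the exponential. The case A =
    setT compares the normalising constants. *)
Lemma hmc_rate_measure_dist Q (eps : R) A : (TV Q G <= eps%:E)%E -> measurable A ->
  let e := ((1 + 2 * B) * eps + tilt_error)%:E in
  (\int[Q]_(y in A) (hmc_rate Q y)%:E <=
     \int[G]_(y in A) (expR (gexp y - B))%:E + e /\
   \int[G]_(y in A) (expR (gexp y - B))%:E <=
     \int[Q]_(y in A) (hmc_rate Q y)%:E + e)%E.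
Proof.
move=> tv mA e.
have mr := measurable_hmc_rate G.
have mt : measurable_fun setT (fun y => expR (gexp y - B)).
  by apply: measurableT_comp => //; exact: measurable_funB.
have r0 y : 0 <= hmc_rate G y by exact: expR_ge0.
have t0 y : 0 <= expR (gexp y - B) by exact: expR_ge0.
have tvC : (TV G Q <= eps%:E)%E by rewrite TV_sym.
have h1 := integral_hmc_rate_TV tv mA.
have h2 := integral_hmc_rate_TV tvC mA.
have h3 := ge0_integral_le_dist G mA mr mt r0 t0.
have h4 := ge0_integral_le_dist G mA mt mr t0 r0.
have k3 := le_trans h3 (leeD2l _ integral_hmc_rate_tilt_dist).
have h5 : (\int[G]_y `|expR (gexp y - B) - hmc_rate G y|%:E <= tilt_error%:E)%E.
  under eq_integral do rewrite distrC.
  exact: integral_hmc_rate_tilt_dist.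
have k4 := le_trans h4 (leeD2l _ h5).
split.
- apply: (le_trans h1); apply: (le_trans (leeD2r _ k3)).
  by rewrite -addeA /e EFinD [X in (_ + X <= _)%E]addeC.
- apply: (le_trans k4); apply: (le_trans (leeD2r _ h2)).
  by rewrite -addeA /e EFinD.
Qed.

End Tilt.
End Rates.
End HiddenMean.


Theorem lemma3p7 (R : realType) :
  exists c C : R, 0 < c /\ 0 < C /\
  forall (m : nat) (mu : m.-tuple R) (Q D : probability (m.-tuple R) R)
    (eps delta b B : R),
    (TV Q (gaussian mu) <= eps%:E)%E ->
    0 < delta <= 1 / 2 ->
    let p := `|Num.ceil (C * ln (2 / delta))|%N in
    ('N[D]_(p%:R%:E)[EFin \o enorm] <= b%:E)%E ->
    0 < B <= 1 ->
    Num.sqrt p%:R * b + b ^+ 2 <= c * B ->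
    forall (d : measure_display) (W : measurableType d) (P : probability W R)
      (src : hmc_source P Q D B),
      [/\ (TV (pushforward P (hmc_output src)) (gaussian (vadd mu (mean D)))
             <= (delta + C * eps)%:E)%E,
          (\int[P]_w hmc_Q_calls src w <= (1 + C * B)%:E)%E
        & (\int[P]_w hmc_Delta_calls src w <= (C * B)%:E)%E].
Proof.
(* 1 / 256 = 4^-4 is at most exp (- 4). *)
exists (1 / 256), 64; split; [by lra|split; [by lra|]].
move=> m mu Q D eps delta b B tv /andP[dl0 dl12] p Lp B01 small d W P src.
have /andP[B0 B1] := B01.
set L := ln (2 / delta).
(* From delta <= 1/2 one gets 2 / delta >= 4 >= e, hence L >= 1 and p >= 64. *)
have d4 : 4 <= 2 / delta by rewrite ler_pdivlMr//; lra.
have eL : expR L = 2 / delta by rewrite lnK// posrE; lra.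
have L1 : 1 <= L.
  by rewrite -ler_expR eL (le_trans _ d4)// expR1_le4.
have pL : 64 * L <= p%:R.
  apply: (le_trans (ceil_ge _)); rewrite /p natr_absz gtr0_norm//.
  by rewrite ceil_gt0 -/L; lra.
have p64 : 64 <= p%:R :> R by lra.
have p2 : (2 <= p)%N by rewrite -(ler_nat R); lra.
have p_neq0 : p%:R != 0 :> R by rewrite pnatr_eq0 -lt0n; exact: leq_trans p2.
have b0 : 0 <= b by rewrite -lee_fin (le_trans _ Lp)// Lnorm_ge0.
have sp0 : 0 <= Num.sqrt p%:R * b by rewrite mulr_ge0// sqrtr_ge0.
have b1 : b <= 1.
  by rewrite -(@expr_le1 _ 2)//; lra.
have b01 : 0 <= b <= 1 by rewrite b0 b1.
have sb : Num.sqrt p%:R * b <= B / 256 by have := sqr_ge0 b; lra.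
have Dp : (\int[D]_u (enorm u ^+ p)%:E <= (b ^+ p)%:E)%E.
  have := powR_Lnorm D (EFin \o enorm) p_neq0.
  have -> : (\int[D]_x (`|(EFin \o enorm) x| `^ p%:R) =
      \int[D]_u (enorm u ^+ p)%:E)%E.
    apply: eq_integral => u _.
    by rewrite /= ger0_norm ?enorm_ge0// powR_mulrn// enorm_ge0.
  move: Lp (Lnorm_ge0 D p%:R%:E (EFin \o @enorm R m)).
  case: ('N[D]_(p%:R%:E)[EFin \o enorm])%E => [r| |]//.
  rewrite !lee_fin poweR_EFin => rb r0 <-.
  by rewrite powR_mulrn// lee_fin lerXn2r.
have mest := @measurable_hmc_est R m B.
have estB y (z : m.-tuple R * m.-tuple R) : `|hmc_est B y z| <= B.
  by apply: clip_norm_le; exact: ltW.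
pose K := prod_prob Q D.
pose a1 := acceptance Q K B (hmc_est B).
have a1ge : expR (- (2 * B)) <= a1 := acceptance_ge Q K B0 mest estB.
have a10 : 0 < a1 := lt_le_trans (expR_gt0 _) a1ge.
have a1V : a1^-1 <= expR (2 * B).
  by rewrite -[leRHS]invrK -expRN lef_pV2// posrE expR_gt0.
have e2B : expR (2 * B) <= 16.
  apply: (@le_trans _ _ (expR 1 * expR 1)); first by rewrite -expRD ler_expR; lra.
  by have := @expR1_le4 R; have := expR_ge0 (1 : R); nra.
have a1V16 : a1^-1 <= 16 := le_trans a1V e2B.
(* From exp (2 B) (1 - 2 B) <= 1 follows exp (2 B) - 1 <= 2 B exp (2 B) <= 32 B. *)
have a1V1 : a1^-1 <= 1 + 32 * B.
  apply: (le_trans a1V).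
  have h1 := expR_ge1Dx (- (2 * B)).
  have h2 : expR (2 * B) * expR (- (2 * B)) = 1 by rewrite -expRD subrr expR0.
  have h3 := expR_ge0 (2 * B).
  nra.
have calls : 2 * B / a1 <= 32 * B by nra.
have eE : (\int[P]_w fors_estimator_calls src (hmc_est B) w = (2 * B / a1)%:E)%E.
  exact: expected_estimator_calls.
split; last 2 first.
(* At most 1 + 32 B proposals and 32 B estimator calls, each of which draws one Y'; the sum is 1 +
   64 B. *)
- rewrite /hmc_Q_calls ge0_integralD//.
  + rewrite eE (expected_proposal_calls src B0 mest estB) -EFinD lee_fin -/K -/a1.
    by lra.
  + by move=> w _; exact: fors_proposal_calls_ge0.
  + exact: measurable_fors_proposal_calls.
  + by move=> w _; exact: fors_estimator_calls_ge0.
  + exact: measurable_fors_estimator_calls.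
- by rewrite /hmc_Delta_calls eE lee_fin; lra.
have e0 : 0 <= eps by rewrite -lee_fin (le_trans (TV_ge0 _ _) tv).
set v := mean D.
have vv : dotp v v <= 2 := dotp_mean_le2 p2 Dp b01.
have vv0 := dotpp_ge0 v.
pose tau := tilt_error B D p b.
have tauE : 8 * tau <= delta.
  by apply: exp_tail_le => //; rewrite sp0 sb.
set out := hmc_output src.
pose e := (1 + 2 * B) * eps + tau.
(* With B <= 1, 8 (1 + 2 B) <= 24 <= 64, and the part 8 tau is at most delta. *)
have eta : 8 * e <= delta + 64 * eps by rewrite /e; nra.
apply: ge_ereal_sup => _ [A mA <-].
(* The unnormalised output and target measures, of masses [a1] and [a2]. *)
pose N1 (A : set (m.-tuple R)) := (\int[Q]_(y in A) (hmc_rate B D Q y)%:E)%E.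
pose N2 (A : set (m.-tuple R)) :=
  (\int[gaussian mu]_(y in A) (expR (dotp v (vsub y mu) - B))%:E)%E.
have N10 A' : (0 <= N1 A')%E by apply: integral_ge0 => y _; rewrite lee_fin expR_ge0.
have N1T : N1 setT = a1%:E by exact: acceptanceE.
have N1le A' : measurable A' -> (N1 A' <= a1%:E)%E.
  move=> mA'; rewrite -N1T; apply: ge0_subset_integral => //.
    by apply/measurable_EFinP; exact: measurable_hmc_rate.
  by move=> y _; rewrite lee_fin expR_ge0.
have N1fin A' : measurable A' -> N1 A' \is a fin_num.
  by move=> mA'; rewrite ge0_fin_numE// (le_lt_trans (N1le _ mA')) ?ltry.
pose a2 := expR (dotp v v / 2 - B).
have N2E A' : measurable A' -> N2 A' = (fine (gaussian (vadd mu v) A') * a2)%:E.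
  move=> mA'; rewrite EFinM fineK ?fin_num_measure//.
  exact: gaussian_tilt_set.
have a24 : 1 / 4 <= a2.
  apply: (@le_trans _ _ (expR (- 1))).
    by rewrite expRN mul1r lef_pV2 ?posrE ?expR_gt0// expR1_le4.
  by rewrite ler_expR; lra.
have dist A' : measurable A' ->
    `|fine (N1 A') - fine (gaussian (vadd mu v) A') * a2| <= e.
  move=> mA'.
  have [] := hmc_rate_measure_dist B0 p2 Dp b01 tv mA'.
  rewrite -/v -/tau -/e -/(N1 A') -/(N2 A') (N2E _ mA') -(fineK (N1fin _ mA')).
  rewrite -!EFinD !lee_fin => h1 h2.
  by rewrite ler_norml; apply/andP; split; lra.
have PA : pushforward P out A = (fine (N1 A) / a1)%:E.
  rewrite EFinM fineK ?N1fin//.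
  exact: (fors_output_law src B0 mest estB mA).
rewrite PA -(fineK (fin_num_measure (gaussian (vadd mu v)) A mA)).
rewrite -EFinB abse_EFin lee_fin; apply: le_trans eta.
apply: (@ratio_dist _ _ (fine (gaussian (vadd mu v) A) * a2) _ a2) => //.
- by rewrite fine_ge0//= -lee_fin fineK ?N1fin ?N1le.
- exact: dist.
(* On the whole space the same bound compares the masses [a1] and [a2]. *)
- by have := dist _ measurableT; rewrite N1T probability_setT /= mul1r.
Qed.
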